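(* Let $A,B$ be real numbers with $-1<B<A\leq1$ and $B\neq0$. Let $f\in\mathcal{A}$ and let $$\mathcal{G}(z):=1-\frac{zf'(z)}{f(z)}+\frac{zf''(z)}{f'(z)},\qquad z\in\mathbb{D}.$$ If any one of the following conditions holds for all $z\in\mathbb{D}$, then $f\in\mathcal{S}^*_{Ne}$: (a) $\left|\left(\dfrac{zf'(z)}{f(z)}\right)\mathcal{G}(z)\right|\leq\dfrac{A-B}{1+|B|}\left(\max\{\beta_1,\beta_2\}\right)^{-1}$, where $$\beta_1=\frac{A-B}{2B}\log\left((1-B)^{-3}\right)\quad\text{and}\quad\beta_2=\frac{A-B}{2B}\log\left((1+B)^{3}\right);$$ (b) $\left|\mathcal{G}(z)\right|\leq\dfrac{A-B}{1+|B|}\left(\max\{\beta_1,\beta_2\}\right)^{-1}$, where $$\beta_1=\frac{A-B}{B\log3}\log\left((1-B)^{-1}\right)\quad\text{and}\quad\beta_2=\frac{A-B}{B\log(5/3)}\log(1+B);$$ (c) $\left|\left(\dfrac{zf'(z)}{f(z)}\right)^{-1}\mathcal{G}(z)\right|\leq\dfrac{A-B}{1+|B|}\left(\max\{\beta_1,\beta_2\}\right)^{-1}$, where $$\beta_1=\frac{A-B}{2B}\log\left((1-B)^{-1}\right)\quad\text{and}\quad\beta_2=\frac{A-B}{2B}\log\left((1+B)^{5}\right).$$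
   Context: $\mathbb{D}=\{z\in\mathbb{C}:|z|<1\}$, $\mathcal{H}$ is the set of all analytic functions on $\mathbb{D}$, and $\mathcal{A}$ is the set of $f\in\mathcal{H}$ with $f(0)=0$ and $f'(0)=1$. For $f,g\in\mathcal{H}$, $f\prec g$ ($f$ is subordinate to $g$) means that there is $w\in\mathcal{H}$ with $w(0)=0$ and $|w(z)|<1$ for $z\in\mathbb{D}$ such that $f(z)=g(w(z))$ on $\mathbb{D}$. With $\varphi_{Ne}(z):=1+z-z^3/3$, $\mathcal{S}^*_{Ne}:=\{f\in\mathcal{A}:zf'(z)/f(z)\prec\varphi_{Ne}(z)\}$. The expressions $zf'(z)/f(z)$, $\mathcal{G}(z)$ and their products are understood as analytic functions on $\mathbb{D}$ (the removable singularity of $zf'(z)/f(z)$ at $0$ being filled with value $1$). $\log$ of a positive number is the natural logarithm. *)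

(* Defs.v *)
(* Stdlib reals with Coquelicot's complex numbers. *)
From Stdlib Require Export Reals.
From Coquelicot Require Export Coquelicot.

Open Scope R_scope.

(* Analytic functions on the open unit disc D are represented by total functions
   C -> C; only their values on D matter.  Analytic means complex
   differentiable at every point of the open set D. *)
Definition analytic_on_disc (f : C -> C) : Prop :=
  forall z : C, Cmod z < 1 ->
    ex_derive (K := C_AbsRing) (V := C_NormedModule) f z.

Definition class_A (f : C -> C) : Prop :=
  analytic_on_disc f /\ f (RtoC 0) = RtoC 0 /\ C_derive f (RtoC 0) = RtoC 1.

Definition subordinate (f g : C -> C) : Prop :=
  analytic_on_disc f /\ analytic_on_disc g /\
  exists w : C -> C,
    analytic_on_disc w /\ w (RtoC 0) = RtoC 0 /\
    (forall z : C, Cmod z < 1 -> Cmod (w z) < 1) /\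
    (forall z : C, Cmod z < 1 -> f z = g (w z)).

(* z f'(z) / f(z), with the removable singularity at 0 filled by 1, its limit
   there for f in class_A.  At any other zero of f the quotient has a pole, so
   the value 0 produced by Coquelicot's total division is never continuous
   there: analyticity of [zf'_over_f f] on D says that f has no zero in D
   other than 0. *)
Definition zf'_over_f (f : C -> C) (z : C) : C :=
  if Ceq_dec z (RtoC 0) then RtoC 1
  else (z * C_derive f z / f z)%C.

(* As above, zeros of f' in D are excluded when this function is analytic. *)
Definition calG (f : C -> C) (z : C) : C :=
  (RtoC 1 - zf'_over_f f z + z * C_derive (C_derive f) z / C_derive f z)%C.

Definition phi_Ne (z : C) : C := (RtoC 1 + z - z ^ 3 / RtoC 3)%C.

Definition starlike_Ne (f : C -> C) : Prop :=
  class_A f /\ subordinate (zf'_over_f f) phi_Ne.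

(* Main.v *)
Require Import Defs.
From Stdlib Require Import Lra Lia ClassicalEpsilon.

(** Put p = z f'/f and G = calG f, so that G = z p'/p.  With beta_2 alone, the three hypotheses say
    that |z w'| <= K, where w = p - 1 and K < 2/3 in (a), w = Log p and K < log (5/3) in (b),
    w = 1/p - 1 and K < 2/5 in (c): this is the inequality log (1+B) / B > 1 / (1+|B|).
    As w(0) = 0, it follows that |w| <= K on D, and in each case |p - 1| < 2/3.  The equation
    w - w^3/3 = p - 1 then has a unique solution in D, which is analytic in z.

    The bound |w| <= K is usually deduced from the Schwarz lemma for z w'.  Here it comes from a
    maximum principle that needs neither Cauchy's theorem nor integrals: p' = G p / z is complex
    differentiable off 0, so that the second derivative test for real functions applies. *)

(** The number 2/3 is the least modulus 1 - 1/3 of w - w^3/3 on the unit circle. The other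
    thresholds follow from it: |Log p| <= K gives |p - 1| <= e^K - 1, and |1/p - 1| <= K gives |p -
    1| <= K / (1 - K), with limiting values K = log (5/3) and K = 2/5. The obstacle is that
    analyticity provides a single complex derivative at each point: f' and p' may not be
    differentiated for free, and zeros are not known to be isolated or of finite order. That f
    vanishes only at 0 and p nowhere is therefore drawn from the equations f' = (p/z) f and p' =
    (G/z) p, valid off the zeros: a zero would spread along its ray down to 0, against f'(0) = 1 and
    p(0) = 1. Case (b) has a circularity besides: Log p is available only while p stays in the right
    half-plane, which is itself a consequence of the bound sought. It is broken by continuity. *)

Notation Cder := (is_derive (K := C_AbsRing) (V := C_NormedModule)).

(** * Complex derivatives in terms of estimates *)

Lemma Cder_iff (f : C -> C) (z l : C) :
  Cder f z l <->
  forall eps, 0 < eps -> exists delta, 0 < delta /\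
    forall y, Cmod (y - z)%C < delta ->
      Cmod (f y - f z - l * (y - z))%C <= eps * Cmod (y - z)%C.
Proof.
split.
- intros [_ H] eps Heps.
  destruct (H z (fun P HP => HP) (mkposreal eps Heps)) as [d Hd].
  exists d; split; [apply cond_pos|].
  intros y Hy. specialize (Hd y Hy).
  rewrite (Cmult_comm l). exact Hd.
- intros H; split.
  + apply (is_linear_scal_l (K := C_AbsRing) (V := C_NormedModule) l).
  + intros x Hx.
    rewrite <- (is_filter_lim_locally_unique (K := C_AbsRing) (V := AbsRing_NormedModule C_AbsRing) z x Hx).
    intros [eps Heps]. destruct (H eps Heps) as [d [Hd Hd']].
    exists (mkposreal d Hd). intros y Hy. specialize (Hd' y Hy).
    rewrite (Cmult_comm l) in Hd'. exact Hd'.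
Qed.

(** The product rule and the identity come over [AbsRing_NormedModule C_AbsRing], analyticity over
    [C_NormedModule]. The error estimates of the two are convertible; only linearity has to be
    proved again. *)
Lemma Cder_ring_iff (f : C -> C) (z l : C) :
  Cder f z l <-> is_derive (K := C_AbsRing) (V := AbsRing_NormedModule C_AbsRing) f z l.
Proof.
split; intros [H1 H2]; split.
- apply (is_linear_scal_l (K := C_AbsRing) (V := AbsRing_NormedModule C_AbsRing) l).
- exact H2.
- apply (is_linear_scal_l (K := C_AbsRing) (V := C_NormedModule) l).
- exact H2.
Qed.

Lemma Cder_eq (f : C -> C) (z l l' : C) : Cder f z l -> l = l' -> Cder f z l'.
Proof. now intros H <-. Qed.

Lemma Cder_mult (f g : C -> C) (z df dg : C) :
  Cder f z df -> Cder g z dg ->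
  Cder (fun y => f y * g y)%C z (df * g z + f z * dg)%C.
Proof.
intros Hf Hg. apply Cder_ring_iff.
apply (is_derive_mult (K := C_AbsRing) f g z df dg).
- now apply Cder_ring_iff.
- now apply Cder_ring_iff.
- intros n m. apply Cmult_comm.
Qed.

Lemma Cder_plus (f g : C -> C) (z df dg : C) :
  Cder f z df -> Cder g z dg -> Cder (fun y => f y + g y)%C z (df + dg)%C.
Proof. apply (is_derive_plus (K := C_AbsRing) (V := C_NormedModule)). Qed.

Lemma Cder_const (c z : C) : Cder (fun _ => c) z (RtoC 0).
Proof. apply (is_derive_const (K := C_AbsRing) (V := C_NormedModule)). Qed.

Lemma Cder_id (z : C) : Cder (fun y => y) z (RtoC 1).
Proof. apply Cder_ring_iff, (is_derive_id (K := C_AbsRing)). Qed.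

Lemma Cder_comp (f g : C -> C) (z df dg : C) :
  Cder f (g z) df -> Cder g z dg -> Cder (fun y => f (g y)) z (dg * df)%C.
Proof.
intros Hf Hg. apply (is_derive_comp (K := C_AbsRing) (V := C_NormedModule) f g z df dg Hf).
now apply Cder_ring_iff.
Qed.

Lemma Cder_ext (f g : C -> C) (z l : C) (d : R) :
  0 < d -> (forall y, Cmod (y - z)%C < d -> f y = g y) -> Cder f z l -> Cder g z l.
Proof.
intros Hd H. apply is_derive_ext_loc.
now exists (mkposreal d Hd).
Qed.

Definition Ccont (f : C -> C) (z : C) := forall eps, 0 < eps ->
  exists delta, 0 < delta /\ forall y, Cmod (y - z)%C < delta -> Cmod (f y - f z)%C < eps.

Lemma Cmod_sub_sym (x y : C) : Cmod (x - y)%C = Cmod (y - x)%C.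
Proof. rewrite <- Cmod_opp. f_equal. ring. Qed.

Lemma Cmod_triangle_inv (x y : C) : Cmod x - Cmod y <= Cmod (x - y)%C.
Proof.
pose proof (Cmod_triangle (x - y) y) as H. replace (x - y + y)%C with x in H by ring. lra.
Qed.

Lemma punctured_disc_open (z : C) (r : R) : z <> RtoC 0 -> Cmod z < r ->
  exists d, 0 < d /\ forall y, Cmod (y - z)%C < d -> y <> RtoC 0 /\ Cmod y < r.
Proof.
intros Hz Hzr. assert (Hp : 0 < Cmod z) by now apply Cmod_gt_0.
exists (Rmin (Cmod z) (r - Cmod z)). split; [apply Rmin_glb_lt; lra|].
intros y Hy.
pose proof (Rlt_le_trans _ _ _ Hy (Rmin_l _ _)).
pose proof (Rlt_le_trans _ _ _ Hy (Rmin_r _ _)).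
split.
- intros ->. rewrite Cmod_sub_sym in H. replace (z - RtoC 0)%C with z in H by ring. lra.
- pose proof (Cmod_triangle_inv y z). lra.
Qed.

Lemma Cder_cont (f : C -> C) (z l : C) : Cder f z l -> Ccont f z.
Proof.
intros H eps Heps. apply Cder_iff with (eps := 1) in H; [|lra].
destruct H as [d [Hd H]].
set (M := 1 + Cmod l). assert (HM : 0 < M) by (unfold M; pose proof (Cmod_ge_0 l); lra).
exists (Rmin d (eps / M)). split.
- apply Rmin_glb_lt; auto. now apply Rdiv_lt_0_compat.
- intros y Hy. specialize (H y (Rlt_le_trans _ _ _ Hy (Rmin_l _ _))).
  replace (f y - f z)%C with ((f y - f z - l * (y - z)) + l * (y - z))%C by ring.
  eapply Rle_lt_trans; [apply Cmod_triangle|]. rewrite Cmod_mult.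
  apply Rle_lt_trans with (M * Cmod (y - z)%C); [unfold M; lra|].
  apply Rlt_le_trans with (M * (eps / M)).
  + apply Rmult_lt_compat_l; auto. eapply Rlt_le_trans; [exact Hy|apply Rmin_r].
  + right; field; lra.
Qed.

Lemma Cder_inv_id (z : C) : z <> RtoC 0 -> Cder Cinv z (- / (z * z))%C.
Proof.
intros Hz. apply Cder_iff. intros eps Heps.
assert (Hm : 0 < Cmod z) by now apply Cmod_gt_0.
set (m := Cmod z) in *.
(* |y - z| < m/2 keeps |y| > m/2, so the remainder (y - z)^2 / (y z^2) is at most 2 |y - z|^2 /
   m^3. *)
exists (Rmin (m / 2) (eps * m ^ 3 / 2)). split.
- apply Rmin_glb_lt; [lra|]. assert (0 < m ^ 3) by now apply pow_lt. nra.
- intros y Hy.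
  assert (H1 := Rlt_le_trans _ _ _ Hy (Rmin_l _ _)).
  assert (H2 := Rlt_le_trans _ _ _ Hy (Rmin_r _ _)).
  assert (Hy2 : m / 2 < Cmod y).
  { pose proof (Cmod_triangle_inv z y). rewrite Cmod_sub_sym in H. fold m in H. lra. }
  assert (Hy0 : y <> RtoC 0) by (apply Cmod_gt_0; lra).
  replace (/ y - / z - - / (z * z) * (y - z))%C with ((y - z) * (y - z) * / (y * (z * z)))%C
    by (field; auto).
  rewrite !Cmod_mult, Cmod_inv, !Cmod_mult by (repeat apply Cmult_neq_0; auto).
  fold m.
  set (d := Cmod (y - z)%C) in *. assert (0 <= d) by apply Cmod_ge_0.
  rewrite (Rmult_comm eps), Rmult_assoc. apply Rmult_le_compat_l; auto.
  assert (0 < m * m) by nra.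
  assert (0 < Cmod y * (m * m)) by (apply Rmult_lt_0_compat; lra).
  apply Rmult_le_reg_r with (Cmod y * (m * m)); [lra|].
  rewrite Rmult_assoc, Rinv_l by lra.
  assert (m/2 * (m*m) * eps <= Cmod y * (m*m) * eps) by
   (apply Rmult_le_compat_r; [lra|]; apply Rmult_le_compat_r; lra).
  replace (eps * m^3/2) with (m/2 * (m*m) * eps) in H2 by field. lra.
Qed.

Lemma Cder_inv (f : C -> C) (z l : C) :
  Cder f z l -> f z <> RtoC 0 -> Cder (fun y => / f y)%C z (- l / (f z * f z))%C.
Proof.
intros Hf H0. eapply Cder_eq.
- apply (Cder_comp Cinv f); [now apply Cder_inv_id|exact Hf].
- field. auto.
Qed.

Lemma Cder_pow (f : C -> C) (z l : C) (n : nat) :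
  Cder f z l -> Cder (fun y => f y ^ S n)%C z (RtoC (INR (S n)) * f z ^ n * l)%C.
Proof.
intros Hf. induction n as [|n IH].
- eapply Cder_eq; [apply Cder_mult; [exact Hf|apply (Cder_const 1)]|]. simpl. ring.
- eapply Cder_eq.
  + apply (Cder_mult f (fun y => f y ^ S n)%C); [exact Hf|exact IH].
  + rewrite (S_INR (S n)), RtoC_plus. simpl Cpow. ring.
Qed.

Lemma C_derive_Cder (f : C -> C) (z : C) :
  ex_derive (K := C_AbsRing) (V := C_NormedModule) f z -> Cder f z (C_derive f z).
Proof. now apply C_derive_correct. Qed.

Lemma Cder_C_derive (f : C -> C) (z l : C) : Cder f z l -> C_derive f z = l.
Proof. apply is_C_derive_unique. Qed.

(** The passage from complex to real calculus: through it the mean value theorem and the second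
    derivative test apply to complex functions on a line. *)
Lemma is_derive_ray (f : C -> C) (z d l : C) (t : R) :
  Cder f (z + RtoC t * d)%C l ->
  is_derive (fun s : R => Re (f (z + RtoC s * d)%C)) t (Re (l * d)%C) /\
  is_derive (fun s : R => Im (f (z + RtoC s * d)%C)) t (Im (l * d)%C).
Proof.
intros H.
assert (E : forall eps : posreal, exists delta, 0 < delta /\ forall s, Rabs (s - t) < delta ->
   Cmod (f (z + RtoC s * d) - f (z + RtoC t * d) - RtoC (s - t) * (l * d))%C <= eps * Rabs (s - t)).
{ intros [eps Heps].
  set (M := 1 + Cmod d). assert (HM : 0 < M) by (unfold M; pose proof (Cmod_ge_0 d); lra).
  apply Cder_iff with (eps := eps / M) in H; [|now apply Rdiv_lt_0_compat].
  destruct H as [de [Hde H]]. exists (de / M). split; [now apply Rdiv_lt_0_compat|].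
  intros s Hs.
  assert (Eq : ((z + RtoC s * d) - (z + RtoC t * d) = RtoC (s - t) * d)%C)
    by (rewrite RtoC_minus; ring).
  specialize (H (z + RtoC s * d)%C). rewrite Eq in H. rewrite Cmod_mult, Cmod_R in H.
  replace (RtoC (s - t) * (l * d))%C with (l * (RtoC (s - t) * d))%C by ring.
  assert (HdM : Cmod d <= M) by (unfold M; lra).
  assert (HMM : Rabs (s - t) * M < de).
  { apply Rmult_lt_reg_r with (/ M); [now apply Rinv_0_lt_compat|].
    rewrite Rmult_assoc, Rinv_r by lra. lra. }
  pose proof (Rabs_pos (s - t)) as Hp. pose proof (Cmod_ge_0 d) as Hd0.
  eapply Rle_trans; [apply H|].
  - eapply Rle_lt_trans; [|exact HMM]. now apply Rmult_le_compat_l.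
  - simpl. replace (eps * Rabs (s - t)) with (eps / M * (Rabs (s - t) * M)) by (field; lra).
    apply Rmult_le_compat_l; [left; now apply Rdiv_lt_0_compat|]. now apply Rmult_le_compat_l. }
split; (split; [apply (is_linear_scal_l (K := R_AbsRing) (V := R_NormedModule))|]);
  intros x Hx; rewrite <- (is_filter_lim_locally_unique (K := R_AbsRing) (V := R_NormedModule) t x Hx);
  intros eps; destruct (E eps) as [de [Hde E']]; exists (mkposreal de Hde);
  intros s Hs; specialize (E' s Hs); 
  (eapply Rle_trans; [|exact E']).
- eapply Rle_trans; [|apply re_le_Cmod]. right. 
  change (Rabs (Re (f (z + s * d)%C) - Re (f (z + t * d)%C) - (s - t) * Re (l * d)%C) =
   Rabs (Re (f (z + RtoC s * d) - f (z + RtoC t * d) - RtoC (s - t) * (l * d))%C)).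
  f_equal. destruct (f (z + s * d)%C), (f (z + t * d)%C), (l*d)%C. simpl. ring.
- eapply Rle_trans; [|eapply Rle_trans; [apply Rmax_r|apply Rmax_Cmod]]. right. 
  change (Rabs (Im (f (z + s * d)%C) - Im (f (z + t * d)%C) - (s - t) * Im (l * d)%C) =
   Rabs (Im (f (z + RtoC s * d) - f (z + RtoC t * d) - RtoC (s - t) * (l * d))%C)).
  f_equal. destruct (f (z + s * d)%C), (f (z + t * d)%C), (l*d)%C. simpl. ring.
Qed.

Lemma Cmod_lt_coord (z : C) (d : R) :
  Rabs (fst z) < d -> Rabs (snd z) < d -> Cmod z < 2 * d.
Proof.
intros H1 H2. eapply Rle_lt_trans; [apply Cmod_2Rmax|].
assert (Hm : Rmax (Rabs (fst z)) (Rabs (snd z)) < d) by now apply Rmax_lub_lt.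
assert (H : sqrt 2 <= 2).
{ rewrite <- (sqrt_square 2) at 2 by lra. apply sqrt_le_1; lra. }
assert (H0 : 0 <= Rmax (Rabs (fst z)) (Rabs (snd z)))
  by (eapply Rle_trans; [apply Rabs_pos|apply Rmax_l]).
pose proof (Rmult_le_compat_r _ _ _ H0 H). lra.
Qed.

(** * Maximum principle and Jack's lemma *)

(** If no maximum existed, each point would have a neighbourhood on which g stays below some value g
    s with s in K. Finitely many neighbourhoods cover K, and the s with the largest value lies in
    one of them, hence is beaten by a value no larger than its own. Minima are obtained by applying
    this to - g. *)
Lemma usc_max (K : C -> Prop) (g : C -> R) (r : R) :
  (forall z, K z -> Cmod z <= r) -> (exists z, K z) ->
  (forall z, ~ K z -> exists d, 0 < d /\ forall y, Cmod (y - z)%C < d -> ~ K y) ->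
  (forall z c, K z -> g z < c ->
     exists d, 0 < d /\ forall y, K y -> Cmod (y - z)%C < d -> g y < c) ->
  exists z, K z /\ forall y, K y -> g y <= g z.
Proof.
intros Hb [k0 Hk0] Hcl Husc.
apply NNPP; intros Hno.
assert (Hnext : forall z, K z -> exists s, K s /\ g z < g s).
{ intros z Hz. apply NNPP; intros H. apply Hno. exists z; split; auto.
  intros y Hy. apply Rnot_lt_le. intros Hlt. apply H. now exists y. }
(* The factor 2 is for [compactness_list], whose closeness is by coordinates: coordinates within d
   give modulus below 2 d. *)
assert (Hloc : forall t : C, exists ds : posreal * C,
  K (snd ds) /\ forall y, K y -> Cmod (y - t)%C < 2 * fst ds -> g y < g (snd ds)).
{ intros t. destruct (classic (K t)) as [Ht|Ht].
  - destruct (Hnext t Ht) as [s [Hs Hts]]. destruct (Husc t (g s) Ht Hts) as [d [Hd H]].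
    assert (Hd2 : 0 < d / 2) by lra.
    exists (mkposreal _ Hd2, s). split; auto. intros y Hy Hyt. apply H; auto.
    simpl in Hyt. lra.
  - destruct (Hcl t Ht) as [d [Hd H]].
    assert (Hd2 : 0 < d / 2) by lra.
    exists (mkposreal _ Hd2, k0). split; auto. intros y Hy Hyt. exfalso. apply (H y); auto.
    simpl in Hyt. lra. }
set (pick := fun t => proj1_sig (constructive_indefinite_description _ (Hloc t))).
assert (Hpick : forall t, K (snd (pick t)) /\
  forall y, K y -> Cmod (y - t)%C < 2 * fst (pick t) -> g y < g (snd (pick t))).
{ intros t. unfold pick. apply proj2_sig. }
set (toC := fun t : Compactness.Tn 2 R => (fst t, fst (snd t)) : C).
refine (compactness_list 2 (- r, (- r, tt)) (r, (r, tt)) (fun t => fst (pick (toC t))) _).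
intros [l Hl].
assert (Hbest : exists s, K s /\ forall t, List.In t l -> g (snd (pick (toC t))) <= g s).
{ clear Hl. induction l as [|t l [s [Hs IH]]].
  - exists k0. split; auto. intros t [].
  - destruct (Rle_lt_dec (g (snd (pick (toC t)))) (g s)) as [Hle|Hlt].
    + exists s. split; auto. intros t' [<-|Ht']; auto.
    + exists (snd (pick (toC t))). split; [apply Hpick|].
      intros t' [<-|Ht']; [lra|]. specialize (IH t' Ht'). lra. }
destruct Hbest as [s [Hs Hbest]].
destruct (Hl (fst s, (snd s, tt))) as [t [Hin [_ Hclose]]].
{ pose proof (Rmax_Cmod s) as H. pose proof (Hb s Hs).
  assert (Rabs (fst s) <= r) by (eapply Rle_trans; [eapply Rle_trans; [apply Rmax_l|apply H]|auto]).
  assert (Rabs (snd s) <= r) by (eapply Rle_trans; [eapply Rle_trans; [apply Rmax_r|apply H]|auto]).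
  simpl. split; [|split; auto]; now apply Rabs_le_between. }
specialize (Hbest t Hin).
assert (Hd : Cmod (s - toC t)%C < 2 * fst (pick (toC t))).
{ destruct t as [t1 [t2 []]]. simpl in Hclose. destruct Hclose as [H1 [H2 _]].
  now apply Cmod_lt_coord. }
destruct (Hpick (toC t)) as [_ Hp]. specialize (Hp s Hs Hd). lra.
Qed.

Lemma MVT_is_derive (f df : R -> R) (a b : R) :
  a < b -> (forall x, a <= x <= b -> is_derive f x (df x)) ->
  exists c, a < c < b /\ f b - f a = df c * (b - a).
Proof.
intros Hab H. destruct (MVT_cor2 f df a b Hab) as [c [H1 H2]].
- intros c Hc. now apply is_derive_Reals, H.
- now exists c.
Qed.

Lemma is_derive_pos_loc (u : R -> R) (x l : R) :
  is_derive u x l -> 0 < l ->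
  exists d, 0 < d /\ forall t, Rabs t < d -> 0 < t * t -> 0 < (u (x + t) - u x) * t.
Proof.
intros H Hl. apply is_derive_Reals in H.
destruct (H (l / 2)) as [d Hd]; [lra|].
exists d. split; [apply cond_pos|]. intros t Ht Ht0.
assert (Hne : t <> 0) by (intros ->; lra).
specialize (Hd t Hne Ht). apply Rabs_def2 in Hd.
replace ((u (x + t) - u x) * t) with ((u (x + t) - u x) / t * (t * t)) by (field; auto).
apply Rmult_lt_0_compat; lra.
Qed.

(** Near 0 the derivative u1 lies above u1 0 on the right and below it on the left. So u rises
    strictly to the right if u1 0 >= 0, and to the left if u1 0 < 0. *)
Lemma second_derivative_no_max (u u1 : R -> R) (l d : R) :
  0 < d -> (forall t, Rabs t < d -> is_derive u t (u1 t)) ->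
  is_derive u1 0 l -> 0 < l -> (forall t, Rabs t < d -> u t <= u 0) -> False.
Proof.
intros Hd Hu Hu1 Hl Hmax.
destruct (is_derive_pos_loc u1 0 l Hu1 Hl) as [e [He H]].
set (m := Rmin d e / 2).
assert (Hm : 0 < m < d /\ m < e).
{ unfold m. pose proof (Rmin_glb_lt d e 0 Hd He). pose proof (Rmin_l d e). pose proof (Rmin_r d e). lra. }
destruct (Rle_lt_dec 0 (u1 0)) as [H0|H0].
- destruct (MVT_is_derive u u1 0 m) as [c [Hc E]]; [lra| |].
  + intros x Hx. apply Hu. rewrite Rabs_pos_eq; lra.
  + specialize (H c). rewrite Rabs_pos_eq, Rplus_0_l in H by lra.
    specialize (Hmax m). rewrite Rabs_pos_eq in Hmax by lra. 
    assert (0 < (u1 c - u1 0) * c) by (apply H; nra). assert (0 < u1 c - u1 0) by nra.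
    assert (0 < u1 c * (m - 0)) by (apply Rmult_lt_0_compat; lra). lra.
- destruct (MVT_is_derive u u1 (-m) 0) as [c [Hc E]]; [lra| |].
  + intros x Hx. apply Hu. rewrite Rabs_left1; lra.
  + specialize (H c). rewrite Rabs_left1, Rplus_0_l in H by lra.
    specialize (Hmax (-m)). rewrite Rabs_left1 in Hmax by lra. 
    assert (0 < (u1 c - u1 0) * c) by (apply H; nra). assert (u1 c - u1 0 < 0) by nra.
    assert (u1 c * (0 - - m) < 0) by nra. lra.
Qed.

Lemma left_max_derivative_nonneg (u : R -> R) (l : R) :
  is_derive u 0 l -> (forall t, -1 < t <= 0 -> u t <= u 0) -> 0 <= l.
Proof.
intros H Hmax. apply Rnot_lt_le; intros Hl.
destruct (is_derive_pos_loc (fun t => - u t) 0 (- l)) as [d [Hd H']].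
- now apply (is_derive_opp (K := R_AbsRing) (V := R_NormedModule)).
- lra.
- pose proof (Rmin_glb_lt d 1 0 Hd Rlt_0_1). pose proof (Rmin_l d 1). pose proof (Rmin_r d 1).
  specialize (H' (- (Rmin d 1 / 2))). rewrite Rabs_left1, Rplus_0_l in H' by lra.
  specialize (Hmax (- (Rmin d 1 / 2))).
  assert (0 < (- u (- (Rmin d 1 / 2)) - - u 0) * - (Rmin d 1 / 2)) by (apply H'; nra). nra.
Qed.

(** Where phi' = 0 the Laplacian of |phi|^2 vanishes and the second derivative test is inconclusive.
    The added term makes the test strict. *)
Definition penalized (phi : C -> C) (delta : R) (z : C) : R :=
  Cmod (phi z) ^ 2 + delta * Cmod z ^ 2.

Lemma penalized_ray (phi : C -> C) (delta : R) (z d l : C) (t : R) :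
  Cder phi (z + RtoC t * d)%C l ->
  is_derive (fun s : R => penalized phi delta (z + RtoC s * d)%C) t
    (2 * (Re (phi (z + RtoC t * d)%C) * Re (l * d)%C + Im (phi (z + RtoC t * d)%C) * Im (l * d)%C)
     + 2 * delta * (Re (z + RtoC t * d)%C * Re d + Im (z + RtoC t * d)%C * Im d)).
Proof.
intros H.
destruct (is_derive_ray _ _ _ _ _ H) as [Hr Hi].
destruct (is_derive_ray (fun y => y) z d (RtoC 1) t (Cder_id _)) as [Zr Zi].
apply (is_derive_ext (fun s =>
  (Re (phi (z + RtoC s * d)%C) ^ 2 + Im (phi (z + RtoC s * d)%C) ^ 2)
   + delta * (Re (z + RtoC s * d)%C ^ 2 + Im (z + RtoC s * d)%C ^ 2))).
{ intros s. unfold penalized. now rewrite !Cmod2_alt. }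
rewrite Cmult_1_l in Zr, Zi.
set (a := fun s => Re (phi (z + RtoC s * d)%C)) in *.
set (b := fun s => Im (phi (z + RtoC s * d)%C)) in *.
set (x := fun s => Re (z + RtoC s * d)%C) in *.
set (y := fun s => Im (z + RtoC s * d)%C) in *.
change (is_derive (fun s : R => (a s ^ 2 + b s ^ 2) + delta * (x s ^ 2 + y s ^ 2)) t
 (2 * (a t * Re (l * d)%C + b t * Im (l * d)%C) + 2 * delta * (x t * Re d + y t * Im d))).
clearbody a b x y.
auto_derive.
- repeat split; eexists; eassumption.
- rewrite (is_derive_unique (fun s : R => a s) _ _ Hr), (is_derive_unique (fun s : R => b s) _ _ Hi),
   (is_derive_unique (fun s : R => x s) _ _ Zr), (is_derive_unique (fun s : R => y s) _ _ Zi). ring.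
Qed.

(* The Laplacian of |phi|^2 + delta |z|^2 is 4 |phi'|^2 + 4 delta > 0, so its second
   derivative is positive along one of the directions 1 and i. *)
Lemma penalized_no_local_max (phi phi1 : C -> C) (z l : C) (delta e : R) :
  0 < delta -> 0 < e ->
  (forall y, Cmod (y - z)%C < e -> Cder phi y (phi1 y)) -> Cder phi1 z l ->
  (forall y, Cmod (y - z)%C < e -> penalized phi delta y <= penalized phi delta z) -> False.
Proof.
intros Hdelta He H1 H2 Hmax.
(* This is Re (conj phi * phi'' d^2), the only part of the second derivative along d that can be
   negative. Since d^2 is 1 for d = 1 and -1 for d = i, it cannot be negative for both. *)
assert (Hdir : forall d : C, Cmod d = 1 ->
   Re (phi z) * Re (l * d * d)%C + Im (phi z) * Im (l * d * d)%C < 0).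
{ intros d Hd. apply Rnot_le_lt; intros Hpos.
  assert (Hin : forall t, Rabs t < e -> Cmod ((z + RtoC t * d) - z)%C < e).
  { intros t Ht. replace ((z + RtoC t * d) - z)%C with (RtoC t * d)%C by ring.
    rewrite Cmod_mult, Cmod_R, Hd. lra. }
  assert (E0 : (z + RtoC 0 * d = z)%C) by ring.
  set (D := Cmod (phi1 z * d)%C ^ 2 + (Re (phi z) * Re (l * d * d)%C + Im (phi z) * Im (l * d * d)%C)).
  apply (second_derivative_no_max (fun s : R => penalized phi delta (z + RtoC s * d)%C)
   (fun t => 2 * (Re (phi (z + RtoC t * d)%C) * Re (phi1 (z + RtoC t * d)%C * d)%C
              + Im (phi (z + RtoC t * d)%C) * Im (phi1 (z + RtoC t * d)%C * d)%C)
     + 2 * delta * (Re (z + RtoC t * d)%C * Re d + Im (z + RtoC t * d)%C * Im d))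
   (2 * D + 2 * delta) e He).
  - intros t Ht. apply penalized_ray. now apply H1, Hin.
  - assert (A1 : Cder phi (z + RtoC 0 * d)%C (phi1 z)).
    { rewrite E0. apply H1. replace (z - z)%C with (RtoC 0) by ring. now rewrite Cmod_0. }
    assert (A2 : Cder (fun y => phi1 y * d)%C (z + RtoC 0 * d)%C (l * d)%C).
    { rewrite E0. eapply Cder_eq; [apply Cder_mult; [exact H2|apply Cder_const]|cbv beta; ring]. }
    destruct (is_derive_ray _ _ _ _ _ A1) as [Hr Hi].
    destruct (is_derive_ray _ _ _ _ _ A2) as [Kr Ki].
    destruct (is_derive_ray (fun y => y) z d (RtoC 1) 0 (Cder_id _)) as [Zr Zi].
    rewrite Cmult_1_l in Zr, Zi.
    assert (B : Re (phi (z + RtoC 0 * d)%C) = Re (phi z) /\ Im (phi (z + RtoC 0 * d)%C) = Im (phi z)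
      /\ Re (phi1 (z + RtoC 0 * d) * d)%C = Re (phi1 z * d)%C
      /\ Im (phi1 (z + RtoC 0 * d) * d)%C = Im (phi1 z * d)%C) by (rewrite E0; auto).
    destruct B as [B1 [B2 [B3 B4]]].
    assert (Bd : Re d ^ 2 + Im d ^ 2 = 1) by (rewrite <- Cmod2_alt, Hd; ring).
    unfold D. rewrite Cmod2_alt.
    set (a := fun s => Re (phi (z + RtoC s * d)%C)) in *.
    set (b := fun s => Im (phi (z + RtoC s * d)%C)) in *.
    set (a1 := fun s => Re (phi1 (z + RtoC s * d) * d)%C) in *.
    set (b1 := fun s => Im (phi1 (z + RtoC s * d) * d)%C) in *.
    set (x := fun s => Re (z + RtoC s * d)%C) in *.
    set (y := fun s => Im (z + RtoC s * d)%C) in *.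
    change (a 0 = Re (phi z)) in B1. change (b 0 = Im (phi z)) in B2.
    change (a1 0 = Re (phi1 z * d)%C) in B3. change (b1 0 = Im (phi1 z * d)%C) in B4.
    match goal with |- is_derive _ _ ?v =>
    change (is_derive (fun t => 2 * (a t * a1 t + b t * b1 t) + 2 * delta * (x t * Re d + y t * Im d)) 0 v) end.
    clearbody a b a1 b1 x y.
    auto_derive.
    + repeat split; eexists; eassumption.
    + rewrite (is_derive_unique (fun s : R => a s) _ _ Hr), (is_derive_unique (fun s : R => b s) _ _ Hi),
       (is_derive_unique (fun s : R => x s) _ _ Zr), (is_derive_unique (fun s : R => y s) _ _ Zi),
       (is_derive_unique (fun s : R => a1 s) _ _ Kr), (is_derive_unique (fun s : R => b1 s) _ _ Ki), B1, B2, B3, B4.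
      replace (2 * delta) with (2 * delta * (Re d ^ 2 + Im d ^ 2)) at 2 by (rewrite Bd; ring).
      ring.
  - unfold D. pose proof (pow2_ge_0 (Cmod (phi1 z * d)%C)). lra.
  - intros t Ht. rewrite E0. apply Hmax. now apply Hin. }
pose proof (Hdir (RtoC 1) Cmod_1) as D1.
pose proof (Hdir Ci Cmod_Ci) as D2.
replace (l * RtoC 1 * RtoC 1)%C with l in D1 by ring.
replace (l * Ci * Ci)%C with (- l)%C in D2.
2:{ destruct l; unfold Ci, Cmult, Copp; simpl; f_equal; ring. }
destruct l as [l1 l2]. simpl in D1, D2. lra.
Qed.

Lemma pow_lt_incr (x y : R) (n : nat) : 0 <= x < y -> x ^ S n < y ^ S n.
Proof.
intros [Hx Hy]. induction n as [|n IH]; [simpl; lra|].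
change (x * x ^ S n < y * y ^ S n).
apply Rmult_le_0_lt_compat; auto. now apply pow_le.
Qed.

Lemma penalized_usc (phi : C -> C) (delta : R) (z : C) (c : R) :
  0 <= delta -> Ccont phi z -> penalized phi delta z < c ->
  exists d, 0 < d /\ forall y, Cmod (y - z)%C < d -> penalized phi delta y < c.
Proof.
intros Hdelta Hphi Hc. unfold penalized in *.
set (a := Cmod (phi z)) in *. set (b := Cmod z) in *.
assert (Ha : 0 <= a) by apply Cmod_ge_0. assert (Hb : 0 <= b) by apply Cmod_ge_0.
set (gap := c - (a ^ 2 + delta * b ^ 2)). assert (Hg : 0 < gap) by (unfold gap; lra).
set (M := 2 * a + 1 + delta * (2 * b + 1)).
assert (HM : 0 < M) by (unfold M; nra).
set (e := Rmin 1 (gap / M)).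
assert (Hq : 0 < gap / M) by now apply Rdiv_lt_0_compat.
assert (He : 0 < e <= 1) by (split; [apply Rmin_glb_lt; lra|apply Rmin_l]).
destruct (Hphi e) as [d [Hd H]]; [lra|].
exists (Rmin d e). split; [apply Rmin_glb_lt; lra|]. intros y Hy.
specialize (H y (Rlt_le_trans _ _ _ Hy (Rmin_l _ _))).
assert (Hy2 := Rlt_le_trans _ _ _ Hy (Rmin_r _ _)).
assert (K1 := Cmod_triangle_inv (phi y) (phi z)). fold a in K1.
assert (K2 := Cmod_triangle_inv y z). fold b in K2.
pose proof (Cmod_ge_0 (phi y)). pose proof (Cmod_ge_0 y).
assert (L1 : Cmod (phi y) ^ 2 < a ^ 2 + (2 * a + 1) * e) by nra.
assert (L2 : Cmod y ^ 2 <= b ^ 2 + (2 * b + 1) * e) by nra.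
assert (L3 : delta * Cmod y ^ 2 <= delta * (b ^ 2 + (2 * b + 1) * e)) by now apply Rmult_le_compat_l.
assert (L4 : M * e <= gap).
{ apply Rle_trans with (M * (gap / M)); [apply Rmult_le_compat_l; [lra|apply Rmin_r]|right; field; lra]. }
unfold M in L4. unfold gap in L4. lra.
Qed.

(** Interior points other than 0 are excluded by the Laplacian. At 0, where only continuity of phi
    is at hand, the penalized function is 0, while on |z| = r it is at least delta r^2. *)
Lemma penalized_max_boundary (phi phi1 : C -> C) (delta r R0 : R) :
  0 < delta -> 0 < r < R0 -> phi (RtoC 0) = RtoC 0 -> Ccont phi (RtoC 0) ->
  (forall z, z <> RtoC 0 -> Cmod z < R0 -> Cder phi z (phi1 z) /\ exists l, Cder phi1 z l) ->
  exists z, Cmod z = r /\ forall y, Cmod y <= r -> penalized phi delta y <= penalized phi delta z.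
Proof.
intros Hdelta Hr Hphi0 Hcont Hder.
destruct (usc_max (fun z => Cmod z <= r) (penalized phi delta) r) as [z [Hz Hmax]].
- auto.
- exists (RtoC 0). rewrite Cmod_0. lra.
- intros z Hz. exists (Cmod z - r). split; [lra|]. intros y Hy.
  pose proof (Cmod_triangle_inv z y). rewrite Cmod_sub_sym in H. lra.
- intros z c Hz Hc.
  destruct (penalized_usc phi delta z c) as [d [Hd H]]; [lra| |exact Hc|].
  + destruct (Ceq_dec z (RtoC 0)) as [->|Hz0]; auto.
    apply (Cder_cont phi z (phi1 z)). apply Hder; auto. lra.
  + exists d. auto.
- exists z. split; auto.
  destruct (Req_dec (Cmod z) r) as [|Hne]; auto. exfalso.
  assert (Hlt : Cmod z < r) by lra.
  assert (Hz0 : z <> RtoC 0).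
  { intros ->. specialize (Hmax (RtoC r)). unfold penalized in Hmax.
    rewrite Hphi0, Cmod_0, Cmod_R, Rabs_pos_eq in Hmax by lra.
    specialize (Hmax (Rle_refl r)). 
    pose proof (pow2_ge_0 (Cmod (phi (RtoC r)))).
    assert (0 < delta * r ^ 2) by (apply Rmult_lt_0_compat; nra). lra. }
  destruct (Hder z Hz0) as [_ [l Hl]]; [lra|].
  destruct (punctured_disc_open z r Hz0 Hlt) as [e [He Hin]].
  apply (penalized_no_local_max phi phi1 z l delta e); auto.
  + intros y Hy. destruct (Hin y Hy). apply Hder; auto. lra.
  + intros y Hy. apply Hmax. destruct (Hin y Hy). lra.
Qed.

(** Twice the right-hand side is the derivative at t = 0 of the penalized function at (1 + t) z, and
    the points with -1 < t <= 0 stay in the disc. *)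
Lemma penalized_radial (phi : C -> C) (delta : R) (z l : C) :
  Cder phi z l ->
  (forall y, Cmod y <= Cmod z -> penalized phi delta y <= penalized phi delta z) ->
  0 <= Re (Cconj (phi z) * (l * z))%C + delta * Cmod z ^ 2.
Proof.
intros H Hmax.
assert (E0 : (z + RtoC 0 * z = z)%C) by ring.
assert (Hd := penalized_ray phi delta z z l 0). rewrite E0 in Hd.
specialize (Hd H). apply left_max_derivative_nonneg in Hd.
- rewrite Cmod2_alt. destruct (phi z), (l * z)%C, z; simpl in *. lra.
- intros t Ht. rewrite E0. apply Hmax.
  replace (z + RtoC t * z)%C with (RtoC (1 + t) * z)%C by (rewrite RtoC_plus; ring).
  rewrite Cmod_mult, Cmod_R, Rabs_pos_eq by lra. pose proof (Cmod_ge_0 z). nra.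
Qed.

Lemma Cder_linear_bound (w : C -> C) (l : C) :
  w (RtoC 0) = RtoC 0 -> Cder w (RtoC 0) l ->
  exists M d, 0 < M /\ 0 < d /\ forall y, Cmod y < d -> Cmod (w y) <= M * Cmod y.
Proof.
intros H0 H. apply Cder_iff with (eps := 1) in H; [|lra].
destruct H as [d [Hd H]]. exists (1 + Cmod l), d. pose proof (Cmod_ge_0 l).
repeat split; auto; [lra|]. intros y Hy.
specialize (H y). rewrite H0 in H. replace (y - RtoC 0)%C with y in H by ring.
specialize (H Hy). replace (w y - RtoC 0 - l * y)%C with (w y - l * y)%C in H by ring.
pose proof (Cmod_triangle_inv (w y) (l * y)%C) as T. rewrite Cmod_mult in T. lra.
Qed.

(** * Powers of w divided by powers of z *)

Lemma Cpow_0 (n : nat) : (RtoC 0 ^ S n = RtoC 0)%C.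
Proof. simpl. ring. Qed.

Lemma Cpow_neq_0 (z : C) (n : nat) : z <> RtoC 0 -> (z ^ n)%C <> RtoC 0.
Proof. intros Hz. apply Cmod_gt_0. rewrite Cmod_pow. now apply pow_lt, Cmod_gt_0. Qed.

Section PowerQuotient.
Variables (w w1 : C -> C) (n : nat).
(** w^(m+1) / z^m with m = n + 1. If w(0) = 0, the total inverse gives the value 0 at 0, which is
    also the limit there. *)
Definition powq (z : C) : C := (w z ^ S (S n) * / z ^ S n)%C.
Definition powq1 (z : C) : C :=
  (RtoC (INR (S (S n))) * (w z ^ S n * w1 z) * / z ^ S n
   - RtoC (INR (S n)) * (w z ^ S (S n) * / z ^ S (S n)))%C.

Lemma powq_Cder (z : C) : z <> RtoC 0 -> Cder w z (w1 z) -> Cder powq z (powq1 z).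
Proof.
intros Hz Hw. eapply Cder_eq.
- apply Cder_mult.
  + apply (Cder_pow w z (w1 z) (S n) Hw).
  + apply (Cder_inv (fun y => y ^ S n)%C); [apply (Cder_pow (fun y => y) z _ n (Cder_id z))|].
    now apply Cpow_neq_0.
- cbv beta. unfold powq1. assert (Hp : (z ^ n)%C <> RtoC 0) by now apply Cpow_neq_0.
  simpl Cpow. generalize (RtoC (INR (S (S n)))) (RtoC (INR (S n))). intros. field. auto.
Qed.

Lemma powq1_Cder (z l : C) : z <> RtoC 0 -> Cder w z (w1 z) -> Cder w1 z l ->
  exists l', Cder powq1 z l'.
Proof.
intros Hz Hw Hw1. eexists. unfold powq1, Cminus.
apply Cder_plus.
- apply Cder_mult.
  + apply Cder_mult; [apply Cder_const|]. apply Cder_mult; [|exact Hw1].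
    apply (Cder_pow w z _ n Hw).
  + apply (Cder_inv (fun y => y ^ S n)%C); [apply (Cder_pow (fun y => y) z _ n (Cder_id z))|].
    now apply Cpow_neq_0.
- apply (Cder_ext (fun y => - RtoC 1 * (RtoC (INR (S n)) * (w y ^ S (S n) * / y ^ S (S n))))%C _ z _ 1 Rlt_0_1).
  + intros y _. ring.
  + apply Cder_mult; [apply Cder_const|]. apply Cder_mult; [apply Cder_const|]. apply Cder_mult.
    * apply (Cder_pow w z _ (S n) Hw).
    * apply (Cder_inv (fun y => y ^ S (S n))%C); [apply (Cder_pow (fun y => y) z _ (S n) (Cder_id z))|].
      now apply Cpow_neq_0.
Qed.

Lemma powq_0 : w (RtoC 0) = RtoC 0 -> powq (RtoC 0) = RtoC 0.
Proof. intros H. unfold powq. rewrite H, Cpow_0. ring. Qed.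

Lemma Cmod_powq (z : C) : z <> RtoC 0 -> Cmod (powq z) = Cmod (w z) ^ S (S n) / Cmod z ^ S n.
Proof.
intros Hz. unfold powq. rewrite Cmod_mult, Cmod_inv, !Cmod_pow by now apply Cpow_neq_0.
reflexivity.
Qed.

(** |w| <= M |z| near 0 gives |w^(m+1) / z^m| <= M^(m+1) |z|. *)
Lemma powq_cont_0 (l : C) : w (RtoC 0) = RtoC 0 -> Cder w (RtoC 0) l -> Ccont powq (RtoC 0).
Proof.
intros H0 Hw eps Heps.
destruct (Cder_linear_bound w l H0 Hw) as [M [d [HM [Hd H]]]].
assert (HMn : 0 < M ^ S (S n)) by now apply pow_lt.
exists (Rmin d (eps / M ^ S (S n))). split.
- apply Rmin_glb_lt; auto. now apply Rdiv_lt_0_compat.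
- intros y Hy. rewrite powq_0 by auto.
  replace (powq y - RtoC 0)%C with (powq y) by ring.
  replace (y - RtoC 0)%C with y in Hy by ring.
  destruct (Ceq_dec y (RtoC 0)) as [->|Hy0].
  + rewrite powq_0, Cmod_0; auto.
  + rewrite Cmod_powq by auto.
    assert (Hyp : 0 < Cmod y) by now apply Cmod_gt_0.
    assert (Hyn : 0 < Cmod y ^ S n) by now apply pow_lt.
    specialize (H y (Rlt_le_trans _ _ _ Hy (Rmin_l _ _))).
    assert (Hy2 := Rlt_le_trans _ _ _ Hy (Rmin_r _ _)).
    apply Rle_lt_trans with (M ^ S (S n) * Cmod y).
    * apply Rmult_le_reg_r with (Cmod y ^ S n); auto.
      unfold Rdiv. rewrite Rmult_assoc, Rinv_l, Rmult_1_r by lra.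
      replace (M ^ S (S n) * Cmod y * Cmod y ^ S n) with ((M * Cmod y) ^ S (S n))
        by (rewrite Rpow_mult_distr; simpl; ring).
      apply pow_incr. split; auto. apply Cmod_ge_0.
    * apply Rmult_lt_reg_r with (/ M ^ S (S n)); [now apply Rinv_0_lt_compat|].
      replace (M ^ S (S n) * Cmod y * / M ^ S (S n)) with (Cmod y) by (field; lra). exact Hy2.
Qed.

(** The logarithmic derivative z phi'/phi = (m+1) z w'/w - m, multiplied out. *)
Lemma powq1_log (z : C) : z <> RtoC 0 -> w z <> RtoC 0 ->
  (powq1 z * z = powq z * (RtoC (INR (S (S n))) * (z * w1 z / w z) - RtoC (INR (S n))))%C.
Proof.
intros Hz Hw. unfold powq, powq1.
assert (Hp : (z ^ n)%C <> RtoC 0) by now apply Cpow_neq_0.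
simpl Cpow. generalize (RtoC (INR (S (S n)))) (RtoC (INR (S n))). intros. field. auto.
Qed.
End PowerQuotient.

(* A form of Jack's lemma.  With phi = w^(m+1) / z^m a boundary maximum z0 of
   |phi|^2 + delta |z|^2 gives Re ((m+1) z0 w'/w - m) >= - O(delta), so |w(z0)| <= K (m+1)/m
   in the limit delta -> 0, and then m -> oo.  Dividing by z^m only, instead of taking w/z,
   keeps phi(0) = 0, so that the singularity at 0 is harmless. *)
Lemma jack_bound (w w1 : C -> C) (R0 K : R) (l0 : C) :
  w (RtoC 0) = RtoC 0 -> Cder w (RtoC 0) l0 ->
  (forall z, z <> RtoC 0 -> Cmod z < R0 ->
     Cder w z (w1 z) /\ (exists l, Cder w1 z l) /\ Cmod (z * w1 z)%C <= K) ->
  forall z, Cmod z < R0 -> Cmod (w z) <= K.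
Proof.
intros Hw0 Hw0' H z1 Hz1. apply Rnot_lt_le; intros HcK.
set (c := Cmod (w z1)) in *.
assert (HR0 : 0 < R0) by (pose proof (Cmod_ge_0 z1); lra).
assert (HK : 0 <= K).
{ destruct (H (RtoC (R0 / 2))) as [_ [_ HK]].
  - intros E. injection E. lra.
  - rewrite Cmod_R, Rabs_pos_eq; lra.
  - eapply Rle_trans; [apply Cmod_ge_0|exact HK]. }
assert (Hc : 0 < c) by lra.
assert (Hz10 : z1 <> RtoC 0).
{ intros ->. unfold c in Hc. rewrite Hw0, Cmod_0 in Hc. lra. }
set (r := Cmod z1) in *.
assert (Hr : 0 < r) by now apply Cmod_gt_0.
(* n (c - K) > K ensures (n+1) c > (n+2) K, that is, m c > (m+1) K for m = n + 1. *)
destruct (INR_unbounded (K / (c - K))) as [n Hn].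
assert (Heta : 0 < INR (S n) * c - INR (S (S n)) * K).
{ apply Rmult_lt_compat_r with (r := c - K) in Hn; [|lra].
  replace (K / (c - K) * (c - K)) with K in Hn by (field; lra).
  rewrite !S_INR. pose proof (pos_INR n). nra. }
set (eta := INR (S n) * c - INR (S (S n)) * K) in *.
set (phi := powq w n). set (phi1 := powq1 w w1 n).
set (c0 := Cmod (phi z1)).
assert (Hc0 : c0 = c ^ S (S n) / r ^ S n) by (apply Cmod_powq; auto).
assert (Hrn : 0 < r ^ S n) by now apply pow_lt.
assert (Hc0p : 0 < c0) by (rewrite Hc0; apply Rdiv_lt_0_compat; auto; now apply pow_lt).
(* Chosen so that delta r^2 = c0^2 (eta / c) / 2. The radial condition at the maximum has a main
   term of at most - c0^2 eta / c, and the penalty makes up only half of it. *)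
set (delta := c0 ^ 2 * eta / (2 * c * r ^ 2)).
assert (Hdelta : 0 < delta).
{ unfold delta. apply Rdiv_lt_0_compat; [apply Rmult_lt_0_compat; nra|]. 
  apply Rmult_lt_0_compat; nra. }
destruct (penalized_max_boundary phi phi1 delta r R0) as [z0 [Hz0r Hmax]]; auto.
- now apply powq_0.
- now apply (powq_cont_0 w n l0).
- intros z Hz Hzr. destruct (H z Hz Hzr) as [A1 [[l A2] _]]. split.
  + now apply powq_Cder.
  + now apply (powq1_Cder w w1 n z l).
- assert (Hz00 : z0 <> RtoC 0) by (apply Cmod_gt_0; lra).
  destruct (H z0 Hz00) as [A1 [_ A2]]; [lra|].
  (* z0 and z1 lie on the same circle, so the penalties cancel in the comparison, and afterwards the
     powers of r do, which gives |w z0| >= c. *)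
  assert (Hge : c0 <= Cmod (phi z0)).
  { specialize (Hmax z1 (Rle_refl _)). unfold penalized in Hmax. rewrite Hz0r in Hmax. fold r c0 in Hmax.
    apply Rnot_lt_le; intros Hlt. pose proof (Cmod_ge_0 (phi z0)). nra. }
  assert (Hwz0 : c <= Cmod (w z0)).
  { apply Rnot_lt_le; intros Hlt. unfold phi in Hge. rewrite Cmod_powq, Hz0r, Hc0 in Hge by auto.
    apply Rmult_le_reg_r in Hge; [|now apply Rinv_0_lt_compat].
    assert (Cmod (w z0) ^ S (S n) < c ^ S (S n)); [|lra].
    { apply pow_lt_incr. split; auto. apply Cmod_ge_0. } }
  assert (Hwz00 : w z0 <> RtoC 0) by (apply Cmod_gt_0; lra).
  assert (Hrad := penalized_radial phi delta z0 (phi1 z0) (powq_Cder w w1 n z0 Hz00 A1)).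
  rewrite Hz0r in Hrad. specialize (Hrad Hmax).
  unfold phi1 in Hrad. rewrite powq1_log in Hrad by auto. fold phi in Hrad.
  set (q := (z0 * w1 z0 / w z0)%C) in *.
  assert (Hq : Re q <= K / c).
  { apply Rle_trans with (Cmod q); [eapply Rle_trans; [apply Rle_abs|apply re_le_Cmod]|].
    unfold q. rewrite Cmod_div by auto.
    apply Rle_trans with (K / Cmod (w z0)).
    - apply Rmult_le_compat_r; auto. left. apply Rinv_0_lt_compat. lra.
    - apply Rmult_le_compat_l; auto. apply Rinv_le_contravar; lra. }
  replace (Re (Cconj (phi z0) * (phi z0 * (RtoC (INR (S (S n))) * q - RtoC (INR (S n)))))%C)
    with (Cmod (phi z0) ^ 2 * (INR (S (S n)) * Re q - INR (S n))) in Hrad.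
  2:{ rewrite Cmod2_alt. generalize (INR (S (S n))) (INR (S n)). intros.
      destruct (phi z0), q. simpl. ring. }
  assert (Hneg : INR (S (S n)) * Re q - INR (S n) <= - eta / c).
  { pose proof (pos_INR (S (S n))) as Hp. pose proof (Rmult_le_compat_l _ _ _ Hp Hq).
    replace (- eta / c) with (INR (S (S n)) * (K / c) - INR (S n)) by (unfold eta; field; lra). lra. }
  assert (Hsq : c0 ^ 2 <= Cmod (phi z0) ^ 2) by (apply pow_incr; lra).
  replace (delta * r ^ 2) with (c0 ^ 2 * (eta / c) / 2) in Hrad by (unfold delta; field; lra).
  assert (He : 0 < eta / c) by now apply Rdiv_lt_0_compat.
  replace (- eta / c) with (- (eta / c)) in Hneg by (field; lra).
  set (s := Cmod (phi z0) ^ 2) in *. set (h := eta / c) in *.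
  assert (s * (INR (S (S n)) * Re q - INR (S n)) <= s * - h) by (apply Rmult_le_compat_l; nra).
  assert (0 < c0 ^ 2) by nra. nra.
Qed.

Lemma Re_conj_mult_le (a b : C) : Rabs (Re (Cconj a * b)%C) <= Cmod a * Cmod b.
Proof. rewrite <- (Cmod_conj a), <- Cmod_mult. apply re_le_Cmod. Qed.

Lemma Re_conj_self (a b : C) : Re (Cconj a * (a * b))%C = Cmod a ^ 2 * Re b.
Proof. rewrite Cmod2_alt. destruct a, b. simpl. ring. Qed.

(** * Zeros and logarithmic derivatives *)

(* g' is not assumed continuous; the mean value theorem applied to Re (conj (g' z) g) rules out a
   jump of g' at an isolated zero. *)
Lemma derivative_zero_at_zero (g g1 q : C -> C) (z : C) (r : R) :
  0 < r -> (forall y, Cmod (y - z)%C < r -> Cder g y (g1 y)) ->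
  (forall y, Cmod (y - z)%C < r -> g y <> RtoC 0 -> g1 y = (q y * g y)%C) ->
  Ccont q z -> g z = RtoC 0 -> g1 z = RtoC 0.
Proof.
intros Hr Hg Hq Hqc Hz. apply NNPP; intros Hl.
set (l := g1 z) in *. set (m := Cmod l).
assert (Hm : 0 < m) by now apply Cmod_gt_0.
assert (Hgz : Cder g z l).
{ apply Hg. replace (z - z)%C with (RtoC 0) by ring. now rewrite Cmod_0. }
assert (Hgz' := Hgz). apply Cder_iff with (eps := m / 2) in Hgz'; [|lra].
destruct Hgz' as [d1 [Hd1 H1]].
destruct (Hqc 1) as [d2 [Hd2 H2]]; [lra|].
set (Q := Cmod (q z) + 1). assert (HQ : 0 < Q) by (unfold Q; pose proof (Cmod_ge_0 (q z)); lra).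
(* For |y - z| < 1/(3 Q) the bound |g y| <= (3/2) m |y - z| makes |q y * g y| < m/2, whereas the
   mean slope of Re (conj l * g) is at least m^2/2. *)
assert (H3Q : 0 < / (3 * Q)) by (apply Rinv_0_lt_compat; lra).
set (e := Rmin (Rmin r d1) (Rmin d2 (/ (3 * Q)))).
assert (He : 0 < e) by (repeat apply Rmin_glb_lt; lra).
assert (He' : e <= r /\ e <= d1 /\ e <= d2 /\ e <= / (3 * Q)).
{ unfold e. pose proof (Rmin_l (Rmin r d1) (Rmin d2 (/ (3 * Q)))).
  pose proof (Rmin_r (Rmin r d1) (Rmin d2 (/ (3 * Q)))).
  pose proof (Rmin_l r d1). pose proof (Rmin_r r d1).
  pose proof (Rmin_l d2 (/ (3 * Q))). pose proof (Rmin_r d2 (/ (3 * Q))). lra. }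
assert (Hdist : forall s, Cmod ((z + RtoC s * RtoC 1) - z)%C = Rabs s).
{ intros s. replace ((z + RtoC s * RtoC 1) - z)%C with (RtoC s) by ring. apply Cmod_R. }
assert (Hbd : forall s, 0 <= s < e ->
  Cmod (g (z + RtoC s * RtoC 1) - l * RtoC s)%C <= m / 2 * s).
{ intros s Hs. specialize (H1 (z + RtoC s * RtoC 1)%C). rewrite Hdist, Rabs_pos_eq in H1 by lra.
  rewrite Hz in H1. 
  replace (g (z + RtoC s * RtoC 1) - RtoC 0 - l * (z + RtoC s * RtoC 1 - z))%C
    with (g (z + RtoC s * RtoC 1) - l * RtoC s)%C in H1 by ring.
  apply H1. lra. }
set (t := e / 2). assert (Ht : 0 < t < e) by (unfold t; lra).
destruct (MVT_is_derive (fun s => Re (Cconj l * g (z + RtoC s * RtoC 1))%C)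
  (fun s => Re (Cconj l * g1 (z + RtoC s * RtoC 1)%C)%C) 0 t) as [c [Hc E]]; [lra| |].
- intros s Hs.
  assert (Hs' : Cder g (z + RtoC s * RtoC 1)%C (g1 (z + RtoC s * RtoC 1)%C)).
  { apply Hg. rewrite Hdist, Rabs_pos_eq; lra. }
  pose proof (Cder_mult _ _ _ _ _ (Cder_const (Cconj l) _) Hs') as Hm'.
  apply is_derive_ray in Hm'. destruct Hm' as [Hm' _].
  match type of Hm' with is_derive _ _ ?v => replace (Re (Cconj l * g1 (z + RtoC s * RtoC 1)%C)%C) with v end.
  + exact Hm'.
  + f_equal. cbv beta. ring.
- assert (E0 : (z + RtoC 0 * RtoC 1 = z)%C) by ring. rewrite E0, Hz in E.
  replace (Re (Cconj l * RtoC 0)%C) with 0 in E by (destruct l; simpl; ring).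
  assert (Lower : m ^ 2 * t / 2 <= Re (Cconj l * g (z + RtoC t * RtoC 1))%C).
  { replace (Cconj l * g (z + RtoC t * RtoC 1))%C with
      (Cconj l * (l * RtoC t) + Cconj l * (g (z + RtoC t * RtoC 1) - l * RtoC t))%C by ring.
    assert (Re_plus : forall a b : C, Re (a + b)%C = Re a + Re b) by reflexivity.
    rewrite Re_plus, Re_conj_self. fold m. 
    pose proof (Re_conj_mult_le l (g (z + RtoC t * RtoC 1) - l * RtoC t)%C) as B. fold m in B.
    specialize (Hbd t). assert (B2 := Rmult_le_compat_l m _ _ (Rlt_le _ _ Hm) (Hbd ltac:(lra))).
    apply Rabs_le_between in B. change (Re (RtoC t)) with t. lra. }
  set (y := (z + RtoC c * RtoC 1)%C) in *.
  assert (Hyc : Cmod (y - z)%C = c) by (unfold y; rewrite Hdist, Rabs_pos_eq; lra).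
  assert (By := Hbd c ltac:(lra)). fold y in By.
  assert (Blow : m * c - Cmod (g y) <= m / 2 * c).
  { pose proof (Cmod_triangle_inv (l * RtoC c) (g y)) as T.
    rewrite Cmod_sub_sym, Cmod_mult, Cmod_R, Rabs_pos_eq in T by lra. fold m in T. lra. }
  assert (Bup : Cmod (g y) <= 3 / 2 * m * c).
  { pose proof (Cmod_triangle_inv (g y) (l * RtoC c)) as T.
    rewrite Cmod_mult, Cmod_R, Rabs_pos_eq in T by lra. fold m in T. lra. }
  assert (Hgy : g y <> RtoC 0) by (apply Cmod_gt_0; nra).
  assert (Hqy : Cmod (q y) <= Q).
  { specialize (H2 y ltac:(lra)). pose proof (Cmod_triangle_inv (q y) (q z)). unfold Q. lra. }
  rewrite Hq in E by (auto; lra).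
  pose proof (Re_conj_mult_le l (q y * g y)%C) as B. rewrite Cmod_mult in B. fold m in B.
  pose proof (Rle_abs (Re (Cconj l * (q y * g y))%C)) as B3.
  assert (B4 : Cmod (q y) * Cmod (g y) <= Q * (3 / 2 * m * c)) by (apply Rmult_le_compat; auto; apply Cmod_ge_0).
  assert (B5 : m * (Cmod (q y) * Cmod (g y)) <= m * (Q * (3 / 2 * m * c))) by (apply Rmult_le_compat_l; lra).
  assert (Hfin : Q * c < / 3).
  { assert (c < / (3 * Q)) by lra.
    apply Rlt_le_trans with (Q * / (3 * Q)); [now apply Rmult_lt_compat_l|right; field; lra]. }
  assert (B6 : m * (Q * (3 / 2 * m * c)) < m ^ 2 / 2).
  { replace (m * (Q * (3 / 2 * m * c))) with (m ^ 2 * (3 / 2) * (Q * c)) by ring.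
    assert (0 < m ^ 2 * (3 / 2)) by (apply Rmult_lt_0_compat; [now apply pow_lt|lra]).
    pose proof (Rmult_lt_compat_l _ _ _ H Hfin). lra. }
  assert (m ^ 2 * t / 2 <= Re (Cconj l * (q y * g y))%C * t) by lra.
  nra.
Qed.

(* Gronwall along the ray: |g(t z0)|^2 exp (2 M |z0| t) is nondecreasing, M bounding |q|. *)
Lemma zero_propagates_on_ray (g g1 q : C -> C) (z0 : C) :
  (forall z, z <> RtoC 0 -> Cmod z < 1 -> Cder g z (g1 z)) ->
  (forall z, z <> RtoC 0 -> Cmod z < 1 -> Ccont q z) ->
  (forall z, z <> RtoC 0 -> Cmod z < 1 -> g z <> RtoC 0 -> g1 z = (q z * g z)%C) ->
  z0 <> RtoC 0 -> Cmod z0 < 1 -> g z0 = RtoC 0 ->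
  forall t, 0 < t <= 1 -> g (RtoC t * z0)%C = RtoC 0.
Proof.
intros Hg Hqc Hq' Hz0 Hz01 Hgz0 a Ha.
(* The equation is given only off the zeros of g; at a zero both sides vanish. *)
assert (Hq : forall z, z <> RtoC 0 -> Cmod z < 1 -> g1 z = (q z * g z)%C).
{ intros z Hz Hz1. destruct (Ceq_dec (g z) (RtoC 0)) as [E|E]; [|auto].
  rewrite E, Cmult_0_r.
  destruct (punctured_disc_open z 1 Hz Hz1) as [e [He Hin]].
  apply (derivative_zero_at_zero g g1 q z e); auto.
  - intros y Hy. now apply Hg; apply Hin.
  - intros y Hy. now apply Hq'; apply Hin. }
set (r := Cmod z0) in *. assert (Hr : 0 < r) by now apply Cmod_gt_0.
(* The closed annulus a r <= |z| <= r contains the segment and avoids 0, where q may be singular. *)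
destruct (usc_max (fun z => a * r <= Cmod z <= r) (fun z => Cmod (q z)) r) as [zM [_ HM]].
- intros z Hz. lra.
- exists z0. fold r. nra.
- intros z Hz. destruct (Rlt_le_dec (Cmod z) (a * r)) as [Hlt|Hle].
  + exists (a * r - Cmod z). split; [lra|]. intros y Hy [Hy1 _]. pose proof (Cmod_triangle_inv y z). lra.
  + assert (r < Cmod z) by (apply Rnot_le_lt; intros Hle2; apply Hz; lra).
    exists (Cmod z - r). split; [lra|]. intros y Hy [_ Hy1]. pose proof (Cmod_triangle_inv z y) as T.
    rewrite Cmod_sub_sym in T. lra.
- intros z c Hz Hc. destruct (Hqc z) with (eps := c - Cmod (q z)) as [d [Hd H]].
  + apply Cmod_gt_0. nra.
  + lra.
  + lra.
  + exists d; split; auto. intros y _ Hy. specialize (H y Hy).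
    pose proof (Cmod_triangle_inv (q y) (q z)). lra.
- set (M := Cmod (q zM)) in *.
  (* Weight 0 leaves |g|^2 along the ray, with its derivative supplied by [penalized_ray]. *)
  set (N := fun t => penalized g 0 (RtoC 0 + RtoC t * z0)%C).
  assert (E0 : forall t, (RtoC 0 + RtoC t * z0 = RtoC t * z0)%C) by (intros; ring).
  assert (Hseg : forall t, a <= t <= 1 -> Cmod (RtoC t * z0)%C = t * r /\
      (RtoC t * z0)%C <> RtoC 0 /\ Cmod (RtoC t * z0)%C < 1 /\ Cmod (q (RtoC t * z0)%C) <= M).
  { intros t Ht. assert (E : Cmod (RtoC t * z0)%C = t * r) by (rewrite Cmod_mult, Cmod_R, Rabs_pos_eq; fold r; lra).
    repeat split; auto.
    - apply Cmod_gt_0. rewrite E. nra.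
    - rewrite E. nra.
    - apply HM. rewrite E. split; [apply Rmult_le_compat_r; lra|nra]. }
  assert (HN : forall t, N t = Cmod (g (RtoC t * z0)%C) ^ 2).
  { intros t. unfold N, penalized. rewrite E0. ring. }
  destruct (Req_dec a 1) as [->|Ha1]; [now rewrite Cmult_1_l|].
  set (dN := fun t => 2 * (Re (g (RtoC t * z0)%C) * Re (g1 (RtoC t * z0) * z0)%C
                 + Im (g (RtoC t * z0)%C) * Im (g1 (RtoC t * z0) * z0)%C)).
  assert (HdN : forall t, a <= t <= 1 -> is_derive N t (dN t)).
  { intros t Ht. destruct (Hseg t Ht) as [_ [S1 [S2 _]]].
    assert (Hd := Hg _ S1 S2). rewrite <- E0 in Hd at 1.
    apply (penalized_ray g 0 (RtoC 0) z0) in Hd.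
    match type of Hd with is_derive _ _ ?v => replace (dN t) with v end; [exact Hd|].
    rewrite E0. unfold dN. ring. }
  assert (HdN2 : forall t, a <= t <= 1 -> 0 <= dN t + 2 * M * r * N t).
  { intros t Ht. destruct (Hseg t Ht) as [_ [S1 [S2 S3]]]. rewrite HN. unfold dN. rewrite (Hq _ S1 S2).
    set (b := q (RtoC t * z0)%C) in *. set (y := g (RtoC t * z0)%C).
    assert (Hb : - (M * r) <= Re (b * z0)%C).
    { pose proof (re_le_Cmod (b * z0)%C) as B. rewrite Cmod_mult in B. fold r in B.
      assert (Cmod b * r <= M * r) by (apply Rmult_le_compat_r; lra).
      apply Rabs_le_between in B. lra. }
    replace (Re y * Re (b * y * z0)%C + Im y * Im (b * y * z0)%C) with (Cmod y ^ 2 * Re (b * z0)%C).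
    2:{ rewrite Cmod2_alt. destruct y, b, z0. simpl. ring. }
    pose proof (pow2_ge_0 (Cmod y)). nra. }
  clearbody N dN.
  destruct (MVT_is_derive (fun t => N t * exp (2 * M * r * t))
    (fun t => (dN t + 2 * M * r * N t) * exp (2 * M * r * t)) a 1) as [c [Hc E]]; [lra| |].
  + intros t Ht. specialize (HdN t Ht). auto_derive.
    * now exists (dN t).
    * rewrite (is_derive_unique (fun x : R => N x) _ _ HdN). ring.
  + assert (N1 : N 1 = 0) by (rewrite HN, Cmult_1_l, Hgz0, Cmod_0; ring).
    rewrite N1 in E.
    assert (0 <= (dN c + 2 * M * r * N c) * exp (2 * M * r * c) * (1 - a)).
    { apply Rmult_le_pos; [|lra]. apply Rmult_le_pos; [apply HdN2; lra|left; apply exp_pos]. }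
    pose proof (exp_pos (2 * M * r * a)) as Hexp.
    assert (HNa : N a <= 0) by nra.
    rewrite HN in HNa. apply Cmod_eq_0. pose proof (Cmod_ge_0 (g (RtoC a * z0)%C)). nra.
Qed.

Section LogDerivative.
Variable f : C -> C.
Hypothesis hf : class_A f.
Hypothesis hp : analytic_on_disc (zf'_over_f f).
Hypothesis hG : analytic_on_disc (calG f).
Let p := zf'_over_f f.
Let G := calG f.

Lemma p_0 : p (RtoC 0) = RtoC 1.
Proof. unfold p, zf'_over_f. destruct (Ceq_dec _ _); congruence. Qed.

Lemma p_neq_0_eq (z : C) : z <> RtoC 0 -> p z = (z * C_derive f z / f z)%C.
Proof. intros Hz. unfold p, zf'_over_f. destruct (Ceq_dec _ _); congruence. Qed.

Lemma quotient_cont (h : C -> C) (z : C) :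
  analytic_on_disc h -> z <> RtoC 0 -> Cmod z < 1 -> Ccont (fun y => h y * / y)%C z.
Proof.
intros Hh Hz Hz1. eapply Cder_cont. apply Cder_mult.
- now apply C_derive_Cder, Hh.
- apply (Cder_inv (fun y => y)); auto. apply Cder_id.
Qed.

(** Off the zeros f' = (p/z) f, with p/z continuous away from 0. A zero at z would force f (t z) = 0
    for all small t > 0, which contradicts f'(0) = 1. *)
Lemma f_nonzero (z : C) : z <> RtoC 0 -> Cmod z < 1 -> f z <> RtoC 0.
Proof.
intros Hz Hz1 Hfz. destruct hf as [Hf [Hf0 Hf1]].
assert (Hray : forall t, 0 < t <= 1 -> f (RtoC t * z)%C = RtoC 0).
{ apply (zero_propagates_on_ray f (C_derive f) (fun y => p y * / y)%C); auto.
  - intros y _ Hy. now apply C_derive_Cder, Hf.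
  - intros y Hy Hy1. now apply quotient_cont.
  - intros y Hy _ Hfy. rewrite p_neq_0_eq by auto. field. auto. }
assert (H0 : Cder f (RtoC 0) (RtoC 1)).
{ rewrite <- Hf1. apply C_derive_Cder, Hf. rewrite Cmod_0. lra. }
apply Cder_iff with (eps := 1 / 2) in H0; [|lra]. destruct H0 as [d [Hd H]].
assert (Hzp : 0 < Cmod z) by now apply Cmod_gt_0.
set (t := Rmin 1 (d / 2)). assert (Ht : 0 < t <= 1) by (split; [apply Rmin_glb_lt; lra|apply Rmin_l]).
assert (Ht2 : t <= d / 2) by apply Rmin_r.
specialize (H (RtoC t * z)%C). rewrite Hray, Hf0 in H by auto.
replace (RtoC t * z - RtoC 0)%C with (RtoC t * z)%C in H by ring.
replace (RtoC 0 - RtoC 0 - RtoC 1 * (RtoC t * z))%C with (- (RtoC t * z))%C in H by ring.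
rewrite Cmod_opp, Cmod_mult, Cmod_R, Rabs_pos_eq in H by lra.
assert (t * Cmod z < d) by nra. specialize (H H0). nra.
Qed.

Lemma f_derive_eq (z : C) : z <> RtoC 0 -> Cmod z < 1 -> C_derive f z = (p z * f z * / z)%C.
Proof. intros Hz Hz1. rewrite p_neq_0_eq by auto. field. split; auto. now apply f_nonzero. Qed.

(** The second derivative of f exists off 0 because f' agrees with p f / z on a whole neighbourhood.
    This keeps [C_derive (C_derive f)] from being a default value. *)
Lemma f_second_derive_eq (z : C) : z <> RtoC 0 -> Cmod z < 1 ->
  C_derive (C_derive f) z =
  ((C_derive p z * f z + p z * (p z * f z * / z)) * / z - p z * f z * / (z * z))%C.
Proof.
intros Hz Hz1. apply Cder_C_derive.
destruct (punctured_disc_open z 1 Hz Hz1) as [d [Hd H]].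
apply (Cder_ext (fun y => p y * f y * / y)%C _ z _ d Hd).
- intros y Hy. symmetry. now apply f_derive_eq; apply H.
- eapply Cder_eq.
  + apply Cder_mult; [apply Cder_mult|].
    * now apply C_derive_Cder, hp.
    * now apply C_derive_Cder, (proj1 hf).
    * apply (Cder_inv (fun y => y)); auto. apply Cder_id.
  + cbv beta. rewrite f_derive_eq by auto. field. auto.
Qed.

(** Logarithmic differentiation of p = z f'/f gives z p'/p = G. The condition on p z is what makes
    f' z nonzero, so that the division in [calG] is genuine. *)
Lemma p_derive_of_nonzero (z : C) : z <> RtoC 0 -> Cmod z < 1 -> p z <> RtoC 0 ->
  C_derive p z = (G z * / z * p z)%C.
Proof.
intros Hz Hz1 Hpz. unfold G, calG. fold p.
rewrite f_second_derive_eq, f_derive_eq by auto. field. 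
repeat split; auto. now apply f_nonzero.
Qed.

(** A zero would propagate along its ray by p' = (G/z) p and contradict continuity at 0, where p =
    1. *)
Lemma p_nonzero (z : C) : Cmod z < 1 -> p z <> RtoC 0.
Proof.
intros Hz1 Hpz.
assert (H10 : RtoC 1 <> RtoC 0) by (intros E; injection E; lra).
assert (Hz : z <> RtoC 0) by (intros ->; rewrite p_0 in Hpz; auto).
assert (Hray : forall t, 0 < t <= 1 -> p (RtoC t * z)%C = RtoC 0).
{ apply (zero_propagates_on_ray p (C_derive p) (fun y => G y * / y)%C); auto.
  - intros y _ Hy. now apply C_derive_Cder, hp.
  - intros y Hy Hy1. now apply quotient_cont.
  - intros y Hy Hy1 Hpy. now apply p_derive_of_nonzero. }
assert (Hc : Ccont p (RtoC 0)).
{ eapply Cder_cont, C_derive_Cder, hp. rewrite Cmod_0. lra. }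
destruct (Hc (1 / 2)) as [d [Hd H]]; [lra|].
assert (Hzp : 0 < Cmod z) by now apply Cmod_gt_0.
set (t := Rmin 1 (d / 2)). assert (Ht : 0 < t <= 1) by (split; [apply Rmin_glb_lt; lra|apply Rmin_l]).
assert (Ht2 : t <= d / 2) by apply Rmin_r.
specialize (H (RtoC t * z)%C). rewrite Hray, p_0 in H by auto.
replace (RtoC t * z - RtoC 0)%C with (RtoC t * z)%C in H by ring.
replace (RtoC 0 - RtoC 1)%C with (- RtoC 1)%C in H by ring.
rewrite Cmod_opp, Cmod_1, Cmod_mult, Cmod_R, Rabs_pos_eq in H by lra.
assert (t * Cmod z < d) by nra. specialize (H H0). lra.
Qed.

Lemma p_Cder (z : C) : z <> RtoC 0 -> Cmod z < 1 -> Cder p z (G z * / z * p z)%C.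
Proof.
intros Hz Hz1. rewrite <- p_derive_of_nonzero by (auto; now apply p_nonzero).
now apply C_derive_Cder, hp.
Qed.

Lemma p_Cder2 (z : C) : z <> RtoC 0 -> Cmod z < 1 ->
  exists l, Cder (fun y => G y * / y * p y)%C z l.
Proof.
intros Hz Hz1. eexists. apply Cder_mult; [apply Cder_mult|].
- now apply C_derive_Cder, hG.
- apply (Cder_inv (fun y => y)); auto. apply Cder_id.
- now apply C_derive_Cder, hp.
Qed.
End LogDerivative.

(** * Inverting the nephroid map *)

Lemma Cder_analytic (f : C -> C) :
  (forall z, Cmod z < 1 -> exists l, Cder f z l) -> analytic_on_disc f.
Proof. intros H z Hz. destruct (H z Hz) as [l Hl]. now exists l. Qed.

Lemma Cder_cubic (c z : C) : exists l, Cder (fun y => c + y - y ^ 3 / RtoC 3)%C z l.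
Proof.
eexists. apply (Cder_ext (fun y => (c + y) + (- / RtoC 3) * y ^ 3)%C _ z _ 1 Rlt_0_1).
- intros y _. unfold Cdiv. ring.
- apply Cder_plus.
  + apply Cder_plus; [apply Cder_const|apply Cder_id].
  + apply Cder_mult; [apply Cder_const|]. apply (Cder_pow (fun y => y)), Cder_id.
Qed.

Lemma RtoC_3_neq_0 : RtoC 3 <> RtoC 0.
Proof. intros E; injection E; lra. Qed.

Lemma Cmod_div_3 (x : C) : Cmod (x / RtoC 3)%C = Cmod x / 3.
Proof. rewrite Cmod_div by apply RtoC_3_neq_0. rewrite Cmod_R, Rabs_pos_eq; lra. Qed.

(* The root is a fixed point of T w = u + w^3/3, which maps the closed unit disc into
   the open one: where |T w - w| is minimal it vanishes, because |T T w - T w| < |T w - w|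
   unless T w = w. *)
Lemma cubic_root_in_disc (u : C) :
  Cmod u < 2 / 3 -> exists w, Cmod w < 1 /\ (w - w ^ 3 / RtoC 3)%C = u.
Proof.
intros Hu.
set (h := fun y => (- u + y - y ^ 3 / RtoC 3)%C).
destruct (usc_max (fun z => Cmod z <= 1) (fun z => - Cmod (h z)) 1) as [w [Hw Hmax]].
- auto.
- exists (RtoC 0). rewrite Cmod_0. lra.
- intros z Hz. exists (Cmod z - 1). split; [lra|]. intros y Hy.
  pose proof (Cmod_triangle_inv z y) as T. rewrite Cmod_sub_sym in T. lra.
- intros z c Hz Hc. destruct (Cder_cubic (- u)%C z) as [l Hl]. apply Cder_cont in Hl.
  destruct (Hl (c + Cmod (h z))) as [d [Hd H]]; [lra|].
  exists d; split; auto. intros y _ Hy. specialize (H y Hy).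
  change (Cmod (h y - h z)%C < c + Cmod (h z)) in H.
  pose proof (Cmod_triangle_inv (h z) (h y)) as T. rewrite Cmod_sub_sym in T. lra.
- set (y := (u + w ^ 3 / RtoC 3)%C).
  pose proof RtoC_3_neq_0 as H3.
  assert (Hy : Cmod y < 1).
  { unfold y. eapply Rle_lt_trans; [apply Cmod_triangle|]. rewrite Cmod_div_3, Cmod_pow.
    assert (Cmod w ^ 3 <= 1 ^ 3) by (apply pow_incr; split; [apply Cmod_ge_0|lra]). lra. }
  destruct (Ceq_dec y w) as [E|Hne].
  + exists w. rewrite <- E at 1. split; auto. rewrite <- E at 1. unfold y. ring.
  + exfalso. specialize (Hmax y (Rlt_le _ _ Hy)).
    assert (E1 : h w = (w - y)%C) by (unfold h, y; ring).
    (* Applying T once more multiplies w - y by a quotient of modulus below 1, since |w| <= 1 and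
       |y| < 1. *)
    assert (E2 : h y = ((w - y) * ((w * w + w * y + y * y) / RtoC 3))%C).
    { replace (h y) with (y - u - y ^ 3 / RtoC 3)%C by (unfold h; ring).
      replace (y - u)%C with (w ^ 3 / RtoC 3)%C by (unfold y; ring). simpl Cpow. field. }
    rewrite E1, E2, Cmod_mult, Cmod_div_3 in Hmax.
    assert (Hpos : 0 < Cmod (w - y)%C).
    { apply Cmod_gt_0. intros E. apply Hne. replace y with (w - (w - y))%C by ring. rewrite E. ring. }
    assert (Hs : Cmod (w * w + w * y + y * y)%C <= Cmod w * Cmod w + Cmod w * Cmod y + Cmod y * Cmod y).
    { eapply Rle_trans; [apply Cmod_triangle|]. rewrite Cmod_mult. apply Rplus_le_compat_r.
      eapply Rle_trans; [apply Cmod_triangle|]. rewrite !Cmod_mult. lra. }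
    pose proof (Cmod_ge_0 w). pose proof (Cmod_ge_0 y).
    assert (Cmod w * Cmod w <= 1) by nra. assert (Cmod w * Cmod y <= Cmod y) by nra.
    assert (Cmod y * Cmod y <= Cmod y) by nra. nra.
Qed.

(** W comes from a choice of roots and is not assumed continuous. Subtracting the equations at y and
    z gives (W y - w) k (W y) = p y - p z with |k| bounded below, hence first a Lipschitz estimate
    for W and then its derivative. *)
Lemma cubic_implicit_Cder (p W : C -> C) (z l : C) :
  Cmod z < 1 ->
  (forall y, Cmod y < 1 -> Cmod (W y) < 1 /\ (W y - W y ^ 3 / RtoC 3)%C = (p y - RtoC 1)%C) ->
  Cder p z l -> Cder W z (l / (RtoC 1 - W z * W z))%C.
Proof.
intros Hz HW Hp.
pose proof RtoC_3_neq_0 as H3.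
destruct (HW z Hz) as [Hwz Hez]. set (w := W z) in *. set (a := Cmod w) in *.
assert (Ha : 0 <= a) by apply Cmod_ge_0.
(* A lower bound for |k v| uniform in |v| < 1; it is positive because a < 1. *)
set (m := 1 - (1 + a + a * a) / 3). assert (Hm : 0 < m) by (unfold m; nra).
set (k := fun v => (RtoC 1 - (v * v + v * w + w * w) / RtoC 3)%C).
assert (Hk : forall v, Cmod v < 1 -> m <= Cmod (k v)).
{ intros v Hv. unfold k. pose proof (Cmod_triangle_inv (RtoC 1) ((v * v + v * w + w * w) / RtoC 3)%C) as T.
  rewrite Cmod_1, Cmod_div_3 in T.
  assert (Hs : Cmod (v * v + v * w + w * w)%C <= Cmod v * Cmod v + Cmod v * a + a * a).
  { eapply Rle_trans; [apply Cmod_triangle|]. rewrite Cmod_mult. apply Rplus_le_compat_r.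
    eapply Rle_trans; [apply Cmod_triangle|]. rewrite !Cmod_mult. fold a. lra. }
  pose proof (Cmod_ge_0 v). unfold m.
  assert (Cmod v * Cmod v <= 1) by nra. assert (Cmod v * a <= a) by nra. lra. }
assert (Hdiff : forall y, Cmod y < 1 -> ((W y - w) * k (W y) = p y - p z)%C).
{ intros y Hy. destruct (HW y Hy) as [_ E]. 
  replace (p y - p z)%C with ((p y - RtoC 1) - (p z - RtoC 1))%C by ring.
  rewrite <- E, <- Hez. unfold k. simpl Cpow. field. }
assert (Hkw : k w = (RtoC 1 - w * w)%C) by (unfold k; field).
assert (Hk0 : (RtoC 1 - w * w)%C <> RtoC 0).
{ rewrite <- Hkw. apply Cmod_gt_0. specialize (Hk w Hwz). lra. }
apply Cder_iff. intros eps Heps.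
set (M := (1 + Cmod l) / m).
assert (HM : 0 < M) by (unfold M; pose proof (Cmod_ge_0 l); apply Rdiv_lt_0_compat; lra).
assert (Hp1 := Hp). apply Cder_iff with (eps := 1) in Hp1; [|lra].
apply Cder_iff with (eps := eps * m / 2) in Hp; [|nra].
destruct Hp1 as [d1 [Hd1 H1]]. destruct Hp as [d2 [Hd2 H2]].
(* For s < d3 the quadratic error (M s)^2 is at most (eps m / 2) s, the other half of the allowance
   going to p. *)
assert (Hd3 : 0 < eps * m / (2 * (M * M))) by (apply Rdiv_lt_0_compat; nra).
set (d3 := eps * m / (2 * (M * M))) in *.
exists (Rmin (Rmin d1 d2) (Rmin d3 (1 - Cmod z))). split; [repeat apply Rmin_glb_lt; lra|].
intros y Hy.
assert (Hys : Cmod (y - z)%C < d1 /\ Cmod (y - z)%C < d2 /\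
  Cmod (y - z)%C < d3 /\ Cmod (y - z)%C < 1 - Cmod z).
{ pose proof (Rmin_l (Rmin d1 d2) (Rmin d3 (1 - Cmod z))).
  pose proof (Rmin_r (Rmin d1 d2) (Rmin d3 (1 - Cmod z))).
  pose proof (Rmin_l d1 d2). pose proof (Rmin_r d1 d2).
  pose proof (Rmin_l d3 (1 - Cmod z)). pose proof (Rmin_r d3 (1 - Cmod z)). lra. }
destruct Hys as [Y1 [Y2 [Y3 Y4]]].
assert (Hy1 : Cmod y < 1) by (pose proof (Cmod_triangle_inv y z); lra).
specialize (H1 y Y1). specialize (H2 y Y2). specialize (Hdiff y Hy1).
destruct (HW y Hy1) as [Hv _]. assert (Hkv := Hk _ Hv). set (v := W y) in *.
set (s := Cmod (y - z)%C) in *. assert (Hs : 0 <= s) by apply Cmod_ge_0.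
assert (Hlip : Cmod (v - w)%C <= M * s).
{ assert (Cmod (p y - p z)%C <= (1 + Cmod l) * s).
  { pose proof (Cmod_triangle_inv (p y - p z)%C (l * (y - z))%C) as T. rewrite Cmod_mult in T. fold s in T. lra. }
  rewrite <- Hdiff, Cmod_mult in H. 
  assert (Cmod (v - w)%C * m <= Cmod (v - w)%C * Cmod (k v)) by (apply Rmult_le_compat_l; auto; apply Cmod_ge_0).
  apply Rmult_le_reg_r with m; auto. replace (M * s * m) with ((1 + Cmod l) * s) by (unfold M; field; lra). lra. }
change (W z) with w.
(* From (v - w) k v = p y - p z, k w = 1 - w^2 and k w - k v = (v - w) (v + 2 w) / 3. *)
replace (v - w - l / (RtoC 1 - w * w) * (y - z))%C with
  (((p y - p z - l * (y - z)) + (v - w) * (v - w) * ((v + RtoC 2 * w) / RtoC 3)) / k w)%C.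
2:{ rewrite <- Hdiff, Hkw. unfold k. replace (RtoC 2) with (RtoC 1 + RtoC 1)%C by (rewrite <- RtoC_plus; f_equal; ring).
    replace (RtoC 3) with (RtoC 1 + RtoC 1 + RtoC 1)%C in * by (rewrite <- !RtoC_plus; f_equal; ring).
    field. auto. }
assert (Hkw0 := Hk w Hwz).
rewrite Cmod_div by (rewrite Hkw; auto).
apply Rmult_le_reg_r with (Cmod (k w)); [lra|].
unfold Rdiv. rewrite Rmult_assoc, Rinv_l, Rmult_1_r by lra.
eapply Rle_trans; [apply Cmod_triangle|].
rewrite !Cmod_mult, Cmod_div_3.
assert (H23 : Cmod (v + RtoC 2 * w)%C / 3 <= 1).
{ pose proof (Cmod_triangle v (RtoC 2 * w)%C) as T. rewrite Cmod_mult, Cmod_R, Rabs_pos_eq in T by lra. fold a in T. lra. }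
assert (Hsq : Cmod (v - w)%C * Cmod (v - w)%C <= M * s * (M * s)).
{ apply Rmult_le_compat; auto; apply Cmod_ge_0. }
assert (Hq : Cmod (v - w)%C * Cmod (v - w)%C * (Cmod (v + RtoC 2 * w)%C / 3) <= M * s * (M * s)).
{ pose proof (Cmod_ge_0 (v - w)%C). nra. }
assert (Hq2 : M * s * (M * s) <= eps * m / 2 * s).
{ replace (eps * m / 2) with (M * M * d3) by (unfold d3; field; lra).
  replace (M * s * (M * s)) with (M * M * s * s) by ring. apply Rmult_le_compat_r; auto.
  apply Rmult_le_compat_l; nra. }
assert (eps * s * m <= eps * s * Cmod (k w)) by (apply Rmult_le_compat_l; nra).
lra.
Qed.

(* The disc of radius 2/3 about 1 is the largest one about 1 inside the nephroid domain. *)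
Lemma subordinate_phi_Ne_of_disc (p : C -> C) :
  analytic_on_disc p -> p (RtoC 0) = RtoC 1 ->
  (forall z, Cmod z < 1 -> Cmod (p z - RtoC 1)%C < 2 / 3) -> subordinate p phi_Ne.
Proof.
intros Hp Hp0 Hdisc.
(* The condition on z stands under the existential so that a single choice function is total. *)
assert (Hex : forall z, exists w, Cmod z < 1 -> Cmod w < 1 /\ (w - w ^ 3 / RtoC 3)%C = (p z - RtoC 1)%C).
{ intros z. destruct (Rlt_dec (Cmod z) 1) as [Hz|Hz].
  - destruct (cubic_root_in_disc _ (Hdisc z Hz)) as [w Hw]. now exists w.
  - exists (RtoC 0). tauto. }
set (W := fun z => proj1_sig (constructive_indefinite_description _ (Hex z))).
assert (HW : forall z, Cmod z < 1 -> Cmod (W z) < 1 /\ (W z - W z ^ 3 / RtoC 3)%C = (p z - RtoC 1)%C).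
{ intros z. unfold W. apply proj2_sig. }
split; [exact Hp|split].
- apply Cder_analytic. intros z _. apply Cder_cubic.
- exists W. repeat split.
  + apply Cder_analytic. intros z Hz. eexists.
    apply (cubic_implicit_Cder p); auto. now apply C_derive_Cder, Hp.
  + destruct (HW (RtoC 0)) as [H1 H2]; [rewrite Cmod_0; lra|]. rewrite Hp0 in H2.
    set (w := W (RtoC 0)) in *. destruct (Ceq_dec w (RtoC 0)) as [|Hw]; auto. exfalso.
    pose proof RtoC_3_neq_0 as H3.
    assert (E : (w * w)%C = RtoC 3).
    { replace (w * w)%C with (RtoC 3 - (w - w ^ 3 / RtoC 3) * RtoC 3 / w)%C by (simpl Cpow; field; auto).
      rewrite H2. field. auto. }
    apply (f_equal Cmod) in E. rewrite Cmod_mult, Cmod_R, Rabs_pos_eq in E by lra.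
    pose proof (Cmod_ge_0 w). nra.
  + intros z Hz. now apply HW.
  + intros z Hz. destruct (HW z Hz) as [_ E]. unfold phi_Ne.
    replace (RtoC 1 + W z - W z ^ 3 / RtoC 3)%C with (RtoC 1 + (W z - W z ^ 3 / RtoC 3))%C by ring.
    rewrite E. ring.
Qed.

(** * The complex logarithm *)

(** This is |e^zeta - 1| <= e^|zeta| - 1 for zeta = a + i b. Project e^(t zeta) - 1 on the direction
    of its value at t = 1: the derivative of the projection is at most |zeta| e^(t |zeta|), and the
    mean value theorem compares the two sides. *)
Lemma exp_minus_1_bound (a b : R) :
  Cmod (exp a * cos b - 1, exp a * sin b) <= exp (Cmod (a, b)) - 1.
Proof.
set (S := Cmod (a, b)). set (v := (exp a * cos b - 1, exp a * sin b)).
assert (HS : 0 <= S) by apply Cmod_ge_0.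
assert (HS2 : S ^ 2 = a ^ 2 + b ^ 2) by (unfold S; now rewrite Cmod2_alt).
set (N := Cmod v). assert (HN : 0 <= N) by apply Cmod_ge_0.
destruct (Req_dec N 0) as [->|HN0].
{ pose proof (exp_ineq1_le S). lra. }
assert (HN2 : N ^ 2 = (exp a * cos b - 1) ^ 2 + (exp a * sin b) ^ 2) by (unfold N; now rewrite Cmod2_alt).
(* (c, s) is the unit vector along v; the projection of v on it is N. *)
set (c := (exp a * cos b - 1) / N). set (s := exp a * sin b / N).
assert (Hcs : c ^ 2 + s ^ 2 = 1).
{ unfold c, s. replace (((exp a * cos b - 1) / N) ^ 2 + (exp a * sin b / N) ^ 2)
    with (((exp a * cos b - 1) ^ 2 + (exp a * sin b) ^ 2) / N ^ 2) by (field; auto).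
  rewrite <- HN2. field. auto. }
destruct (MVT_is_derive
  (fun t => exp (t * S) - 1 - (c * (exp (t * a) * cos (t * b) - 1) + s * (exp (t * a) * sin (t * b))))
  (fun t => S * exp (t * S) - exp (t * a) *
     (c * (a * cos (t * b) - b * sin (t * b)) + s * (a * sin (t * b) + b * cos (t * b)))) 0 1)
  as [t [Ht E]]; [lra| |].
- intros x _. auto_derive; auto. ring.
- assert (HE : exp (t * a) <= exp (t * S)).
  {
    assert (a <= S) by nra.
    destruct (Rle_lt_or_eq_dec (t * a) (t * S)) as [Hl|He];
      [nra|left; now apply exp_increasing|right; now rewrite He]. }
  assert (HX : c * (a * cos (t * b) - b * sin (t * b)) + s * (a * sin (t * b) + b * cos (t * b)) <= S).
  { set (X := a * cos (t * b) - b * sin (t * b)). set (Y := a * sin (t * b) + b * cos (t * b)).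
    assert (HXY : X ^ 2 + Y ^ 2 = S ^ 2).
    { rewrite HS2. pose proof (sin2_cos2 (t * b)) as T. unfold Rsqr in T. unfold X, Y.
      replace ((a * cos (t * b) - b * sin (t * b)) ^ 2 + (a * sin (t * b) + b * cos (t * b)) ^ 2)
        with ((a ^ 2 + b ^ 2) * (sin (t * b) * sin (t * b) + cos (t * b) * cos (t * b))) by ring.
      rewrite T. ring. }
    clearbody X Y. assert ((c * X + s * Y) ^ 2 + (c * Y - s * X) ^ 2 = S ^ 2).
    { replace ((c * X + s * Y) ^ 2 + (c * Y - s * X) ^ 2) with ((c ^ 2 + s ^ 2) * (X ^ 2 + Y ^ 2)) by ring.
      rewrite Hcs, HXY. ring. }
    pose proof (pow2_ge_0 (c * Y - s * X)). nra. }
  pose proof (exp_pos (t * a)).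
  assert (exp (t * a) *
    (c * (a * cos (t * b) - b * sin (t * b)) + s * (a * sin (t * b) + b * cos (t * b))) <= exp (t * S) * S).
  { apply Rle_trans with (exp (t * a) * S); [apply Rmult_le_compat_l; lra|apply Rmult_le_compat_r; auto]. }
  rewrite !Rmult_0_l, !Rmult_1_l, exp_0, cos_0, sin_0 in E.
  assert (EN : c * (exp a * cos b - 1) + s * (exp a * sin b) = N).
  { unfold c, s. replace ((exp a * cos b - 1) / N * (exp a * cos b - 1) + exp a * sin b / N * (exp a * sin b))
     with (((exp a * cos b - 1) ^ 2 + (exp a * sin b) ^ 2) / N) by (field; auto).
    rewrite <- HN2. field. auto. }
  rewrite EN in E. lra.
Qed.

(* Principal branch on the right half-plane. *)
Definition Clog (w : C) : C := (ln (Re w ^ 2 + Im w ^ 2) / 2, atan (Im w / Re w)).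

(** On the right half-plane exp (Clog w) = w, checked in real coordinates, so [exp_minus_1_bound]
    applies to Clog w. *)
Lemma Clog_bound (w : C) : 0 < Re w -> Cmod (w - RtoC 1)%C <= exp (Cmod (Clog w)) - 1.
Proof.
destruct w as [x y]. simpl Re. intros Hx.
unfold Clog. simpl Re. simpl Im.
eapply Rle_trans; [|apply exp_minus_1_bound]. right. f_equal.
assert (Hr : 0 < x ^ 2 + y ^ 2) by nra.
set (s := sqrt (x ^ 2 + y ^ 2)). assert (Hs : 0 < s) by now apply sqrt_lt_R0.
assert (Hss : s * s = x ^ 2 + y ^ 2) by (apply sqrt_sqrt; lra).
assert (E1 : exp (ln (x ^ 2 + y ^ 2) / 2) = s).
{ rewrite <- Hss, ln_mult by auto. replace ((ln s + ln s) / 2) with (ln s) by field. now apply exp_ln. }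
assert (E2 : sqrt (1 + (y / x)²) = s / x).
{ replace (1 + (y / x)²) with ((s / x) * (s / x)).
  - apply sqrt_square. left. now apply Rdiv_lt_0_compat.
  - unfold Rsqr. replace (s / x * (s / x)) with (s * s / (x * x)) by (field; lra). rewrite Hss. field. lra. }
rewrite E1, cos_atan, sin_atan, E2.
unfold Cminus, Cplus, Copp, RtoC. simpl. f_equal; field; lra.
Qed.

Lemma Clog_1 : Clog (RtoC 1) = RtoC 0.
Proof.
unfold Clog, RtoC. simpl. replace (1 * (1 * 1) + 0 * (0 * 1)) with 1 by ring.
rewrite ln_1. replace (0 / 1) with 0 by field. rewrite atan_0. f_equal. field.
Qed.

(** The mean value theorem is applied to the real and imaginary parts along the segment from w to v,
    which stays in the right half-plane as |v - w| < Re w. The two intermediate points differ;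
    continuity of 1/z bounds each error by eps/2. *)
Lemma Clog_Cder (w : C) : 0 < Re w -> Cder Clog w (/ w)%C.
Proof.
intros Hw.
assert (Hw0 : w <> RtoC 0) by (intros ->; simpl in Hw; lra).
apply Cder_iff. intros eps Heps.
destruct (Cder_cont _ _ _ (Cder_inv_id w Hw0) (eps / 2)) as [d [Hd Hinv]]; [lra|].
exists (Rmin d (Re w)). split; [now apply Rmin_glb_lt|]. intros v Hv.
assert (Hv1 := Rlt_le_trans _ _ _ Hv (Rmin_l _ _)).
assert (Hv2 := Rlt_le_trans _ _ _ Hv (Rmin_r _ _)).
set (h := (v - w)%C) in *.
assert (Hrh : - Re w < Re h).
{ pose proof (re_le_Cmod h) as B. apply Rabs_le_between in B. lra. }
set (X := fun t => Re w + t * Re h). set (Y := fun t => Im w + t * Im h).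
assert (HX : forall t, 0 <= t <= 1 -> 0 < X t).
{ intros t Ht. unfold X. destruct (Rle_lt_dec 0 (Re h)); nra. }
assert (Hseg : forall t, 0 <= t <= 1 -> Cmod ((X t, Y t) - w)%C <= Cmod h).
{ intros t Ht. replace ((X t, Y t) - w)%C with (RtoC t * h)%C.
  - rewrite Cmod_mult, Cmod_R, Rabs_pos_eq by lra. pose proof (Cmod_ge_0 h). nra.
  - unfold X, Y. destruct w, h. unfold Cminus, Cplus, Copp, Cmult, RtoC. simpl. f_equal; ring. }
assert (Herr : forall t, 0 <= t <= 1 -> Cmod (h * / (X t, Y t) - h * / w)%C <= eps / 2 * Cmod h).
{ intros t Ht. replace (h * / (X t, Y t) - h * / w)%C with (h * (/ (X t, Y t) - / w))%C by ring.
  rewrite Cmod_mult, Rmult_comm. apply Rmult_le_compat_r; [apply Cmod_ge_0|].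
  left. apply Hinv. eapply Rle_lt_trans; [now apply Hseg|exact Hv1]. }
assert (Ew : (X 0, Y 0) = w) by (unfold X, Y; destruct w; simpl; f_equal; ring).
assert (Ev : (X 1, Y 1) = v) by (unfold X, Y, h; destruct w, v; simpl; f_equal; ring).
clearbody h.
destruct (MVT_is_derive (fun t => Re (Clog (X t, Y t))) (fun t => Re (h * / (X t, Y t))%C) 0 1)
  as [t1 [Ht1 E1]]; [lra| |].
{ intros t Ht. specialize (HX t Ht). unfold Clog. simpl. unfold X, Y, Re, Im in *.
  assert (Q : 0 < (fst w + t * fst h) ^ 2 + (snd w + t * snd h) ^ 2)
    by (pose proof (pow2_ge_0 (snd w + t * snd h)); pose proof (pow_lt _ 2 HX); lra).
  auto_derive; [lra|]. field. lra. }
destruct (MVT_is_derive (fun t => Im (Clog (X t, Y t))) (fun t => Im (h * / (X t, Y t))%C) 0 1)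
  as [t2 [Ht2 E2]]; [lra| |].
{ intros t Ht. specialize (HX t Ht). unfold Clog. simpl. unfold X, Y, Re, Im in *.
  assert (Q : 0 < (fst w + t * fst h) ^ 2 + (snd w + t * snd h) ^ 2)
    by (pose proof (pow2_ge_0 (snd w + t * snd h)); pose proof (pow_lt _ 2 HX); lra).
  auto_derive; [lra|]. field. split; lra. }
rewrite Ew, Ev in E1, E2.
assert (B1 := Herr t1 ltac:(lra)). assert (B2 := Herr t2 ltac:(lra)).
set (D := (Clog v - Clog w - / w * h)%C).
assert (R1 : Re D = Re (h * / (X t1, Y t1) - h * / w)%C).
{ unfold D. rewrite (Cmult_comm (/ w)). unfold Cminus. simpl in *. lra. }
assert (R2 : Im D = Im (h * / (X t2, Y t2) - h * / w)%C).
{ unfold D. rewrite (Cmult_comm (/ w)). unfold Cminus. simpl in *. lra. }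
assert (A1 : Rabs (Re D) <= eps / 2 * Cmod h).
{ rewrite R1. eapply Rle_trans; [apply re_le_Cmod|exact B1]. }
assert (A2 : Rabs (Im D) <= eps / 2 * Cmod h).
{ rewrite R2. eapply Rle_trans; [|exact B2]. eapply Rle_trans; [apply Rmax_r|apply Rmax_Cmod]. }
replace D with (RtoC (Re D) + Ci * RtoC (Im D))%C.
- eapply Rle_trans; [apply Cmod_triangle|]. rewrite Cmod_mult, Cmod_Ci, !Cmod_R. lra.
- destruct D. unfold Cplus, Cmult, RtoC, Ci. simpl. f_equal; ring.
Qed.

(** * Bounds on the constants and conclusion *)

(** Both signs use ln x < x - 1: with x = 1 + B for B < 0, where the ratio exceeds 1, and with x =
    1/(1 + B) for B > 0, which gives ln (1 + B) > B / (1 + B). *)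
Lemma ln_one_plus_lower (B : R) : -1 < B -> B <> 0 -> / (1 + Rabs B) < ln (1 + B) / B.
Proof.
intros HB HB0. destruct (Rlt_le_dec B 0) as [Hn|Hn].
- rewrite Rabs_left by auto.
  assert (Hl : ln (1 + B) < B).
  { pose proof (exp_ineq1 B HB0) as H. rewrite <- (ln_exp B) at 2. apply ln_increasing; lra. }
  apply Rlt_le_trans with 1.
  + rewrite <- Rinv_1 at 2. apply Rinv_lt_contravar; lra.
  + replace (ln (1 + B) / B) with (- ln (1 + B) / - B) by (field; lra).
    apply Rmult_le_reg_r with (- B); [lra|]. unfold Rdiv. rewrite Rmult_assoc, Rinv_l by lra. lra.
- rewrite Rabs_pos_eq by auto. assert (Hp : 0 < B) by lra.
  assert (Hl : ln (/ (1 + B)) < / (1 + B) - 1).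
  { assert (Hne : / (1 + B) - 1 <> 0).
    { assert (/ (1 + B) < 1); [|lra]. rewrite <- Rinv_1 at 2. apply Rinv_lt_contravar; lra. }
    pose proof (exp_ineq1 _ Hne) as H. rewrite <- (ln_exp (/ (1 + B) - 1)).
    apply ln_increasing; [apply Rinv_0_lt_compat; lra|lra]. }
  rewrite ln_Rinv in Hl by lra.
  apply Rmult_lt_reg_r with B; auto. unfold Rdiv. rewrite Rmult_assoc, Rinv_l, Rmult_1_r by lra.
  replace (/ (1 + B) * B) with (1 - / (1 + B)) by (field; lra). lra.
Qed.

(** Every beta_2 has the form c (A - B) log (1+B) / B, with c = 3/2, 1/log (5/3) and 5/2. The
    maximum is at least beta_2, and A - B cancels. *)
Lemma radius_bound (A B c beta1 : R) : -1 < B -> B < A -> B <> 0 -> 0 < c ->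
  (A - B) / (1 + Rabs B) * / Rmax beta1 (c * (A - B) * (ln (1 + B) / B)) < / c.
Proof.
intros HB HA HB0 Hc.
pose proof (ln_one_plus_lower B HB HB0) as Hl.
set (b2 := c * (A - B) * (ln (1 + B) / B)) in *.
assert (Hpos : 0 < 1 + Rabs B) by (pose proof (Rabs_pos B); lra).
set (s := (A - B) / (1 + Rabs B)). assert (Hs : 0 < s) by (apply Rdiv_lt_0_compat; lra).
assert (Hb : c * s < Rmax beta1 b2).
{ apply Rlt_le_trans with b2; [|apply Rmax_r].
  replace (c * s) with (c * (A - B) * / (1 + Rabs B)) by (unfold s; field; lra).
  apply Rmult_lt_compat_l; auto. apply Rmult_lt_0_compat; lra. }
assert (Hcs : 0 < c * s) by nra.
set (m := Rmax beta1 b2) in *.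
apply Rmult_lt_reg_r with (c * m); [apply Rmult_lt_0_compat; lra|].
replace (s * / m * (c * m)) with (c * s) by (field; lra).
replace (/ c * (c * m)) with m by (field; lra). exact Hb.
Qed.

(* If |z p'/p| <= K then Log p obeys the bound K as long as p stays in the right half-plane;
   since exp K - 1 < 2/3, a point of least modulus with |p - 1| >= 2/3 cannot exist. *)
Lemma log_derivative_disc_bound (p G : C -> C) (K : R) :
  K < ln (5 / 3) -> analytic_on_disc p -> p (RtoC 0) = RtoC 1 -> analytic_on_disc G ->
  (forall z, z <> RtoC 0 -> Cmod z < 1 -> Cder p z (G z * / z * p z)%C) ->
  (forall z, Cmod z < 1 -> Cmod (G z) <= K) ->
  forall z, Cmod z < 1 -> Cmod (p z - RtoC 1)%C < 2 / 3.
Proof.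
intros HK Hp Hp0 HG Hder HGK z1 Hz1. apply Rnot_le_lt; intros Hbad.
assert (Hcont : forall z, Cmod z < 1 -> Ccont p z).
{ intros z Hz. eapply Cder_cont, C_derive_Cder, Hp, Hz. }
destruct (usc_max (fun z => Cmod z <= Cmod z1 /\ 2 / 3 <= Cmod (p z - RtoC 1)%C)
  (fun z => - Cmod z) (Cmod z1)) as [z2 [[Hz2 Hbad2] Hmin]].
- tauto.
- exists z1. split; [lra|exact Hbad].
- intros z Hz. destruct (Rle_lt_dec (Cmod z) (Cmod z1)) as [Hle|Hlt].
  + assert (Hlt : Cmod (p z - RtoC 1)%C < 2 / 3) by (apply Rnot_le_lt; tauto).
    destruct (Hcont z ltac:(lra) (2 / 3 - Cmod (p z - RtoC 1)%C)) as [d [Hd H]]; [lra|].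
    exists d; split; auto. intros y Hy [_ Hy2]. specialize (H y Hy).
    pose proof (Cmod_triangle_inv (p y - RtoC 1)%C (p z - RtoC 1)%C) as T.
    replace (p y - RtoC 1 - (p z - RtoC 1))%C with (p y - p z)%C in T by ring. lra.
  + exists (Cmod z - Cmod z1). split; [lra|]. intros y Hy [Hy1 _].
    pose proof (Cmod_triangle_inv z y) as T. rewrite Cmod_sub_sym in T. lra.
- intros z c Hz Hc. exists (c + Cmod z). split; [lra|]. intros y _ Hy.
  pose proof (Cmod_triangle_inv z y) as T. rewrite Cmod_sub_sym in T. lra.
- set (rho := Cmod z2) in *.
  assert (Hrho1 : rho < 1) by lra.
  assert (Hrho : 0 < rho).
  { apply Cmod_gt_0. intros ->. rewrite Hp0 in Hbad2.
    replace (RtoC 1 - RtoC 1)%C with (RtoC 0) in Hbad2 by ring. rewrite Cmod_0 in Hbad2. lra. }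
  assert (Hin : forall z, Cmod z < rho -> 0 < Re (p z)).
  { intros z Hz. assert (Hlt : Cmod (p z - RtoC 1)%C < 2 / 3).
    { apply Rnot_le_lt; intros Hle. assert (Hz1' : Cmod z <= Cmod z1) by lra.
      specialize (Hmin z (conj Hz1' Hle)). cbv beta in Hmin. lra. }
    pose proof (re_le_Cmod (p z - RtoC 1)%C) as B. apply Rabs_le_between in B.
    change (Re (p z - RtoC 1)%C) with (Re (p z) + - 1) in B. lra. }
  assert (Hlog : forall z, Cmod z < rho -> Cmod (Clog (p z)) <= K).
  { apply (jack_bound (fun z => Clog (p z)) (fun z => G z * / z)%C rho K
      (C_derive p (RtoC 0) * / p (RtoC 0))%C).
    - rewrite Hp0. apply Clog_1.
    - apply (Cder_comp Clog p).
      + apply Clog_Cder, Hin. now rewrite Cmod_0.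
      + apply C_derive_Cder, Hp. rewrite Cmod_0. lra.
    - intros z Hz Hzr. assert (Hpz := Hin z Hzr). assert (Hz1' : Cmod z < 1) by lra.
      assert (Hpz0 : p z <> RtoC 0) by (intros E; rewrite E in Hpz; simpl in Hpz; lra).
      split; [|split].
      + eapply Cder_eq; [apply (Cder_comp Clog p); [apply Clog_Cder; exact Hpz|now apply Hder]|].
        field. auto.
      + eexists. apply Cder_mult.
        * now apply C_derive_Cder, HG.
        * apply (Cder_inv (fun y => y)); auto. apply Cder_id.
      + replace (z * (G z * / z))%C with (G z) by (field; auto). now apply HGK. }
  assert (HeK : exp K < 5 / 3).
  { rewrite <- (exp_ln (5 / 3)) by lra. now apply exp_increasing. }
  (* The bound |p - 1| <= exp K - 1 holds inside |z| < rho. A point y slightly inside on the ray of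
     z2, where p moves by less than 5/3 - exp K, carries it over to |p z2 - 1| < 2/3. *)
  destruct (Hcont z2 Hrho1 (5 / 3 - exp K)) as [d [Hd H]]; [lra|].
  set (s := Rmin (1 / 2) (d / 2)).
  assert (Hs : 0 < s) by (apply Rmin_glb_lt; lra).
  assert (Hs1 : s <= 1 / 2) by apply Rmin_l. assert (Hs2 : s <= d / 2) by apply Rmin_r.
  set (y := (RtoC (1 - s) * z2)%C).
  assert (Hy : Cmod y < rho).
  { unfold y. rewrite Cmod_mult, Cmod_R, Rabs_pos_eq by lra. fold rho. nra. }
  assert (Hyd : Cmod (y - z2)%C < d).
  { replace (y - z2)%C with (- (RtoC s * z2))%C by (unfold y; rewrite RtoC_minus; ring).
    rewrite Cmod_opp, Cmod_mult, Cmod_R, Rabs_pos_eq by lra. fold rho. nra. }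
  specialize (H y Hyd).
  pose proof (Clog_bound (p y) (Hin y Hy)) as B. specialize (Hlog y Hy).
  assert (exp (Cmod (Clog (p y))) <= exp K).
  { destruct (Rle_lt_or_eq_dec _ _ Hlog) as [Hl|He]; [left; now apply exp_increasing|right; now rewrite He]. }
  pose proof (Cmod_triangle_inv (p z2 - RtoC 1)%C (p y - RtoC 1)%C) as T.
  replace (p z2 - RtoC 1 - (p y - RtoC 1))%C with (p z2 - p y)%C in T by ring.
  rewrite (Cmod_sub_sym (p z2) (p y)) in T. lra.
Qed.

Theorem corollary4p1 (A B : R) (hB : -1 < B) (hBA : B < A) (hA : A <= 1)
  (hB0 : B <> 0) (f : C -> C) (hf : class_A f)
  (hp : analytic_on_disc (zf'_over_f f)) (hG : analytic_on_disc (calG f)) :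
  (* (a) *)
  (let beta1 := (A - B) / (2 * B) * ln (/ (1 - B) ^ 3) in
   let beta2 := (A - B) / (2 * B) * ln ((1 + B) ^ 3) in
   forall z : C, Cmod z < 1 ->
     Cmod (zf'_over_f f z * calG f z)%C
       <= (A - B) / (1 + Rabs B) * / Rmax beta1 beta2)
  \/
  (* (b) *)
  (let beta1 := (A - B) / (B * ln 3) * ln (/ (1 - B)) in
   let beta2 := (A - B) / (B * ln (5 / 3)) * ln (1 + B) in
   forall z : C, Cmod z < 1 ->
     Cmod (calG f z)
       <= (A - B) / (1 + Rabs B) * / Rmax beta1 beta2)
  \/
  (* (c) *)
  (let beta1 := (A - B) / (2 * B) * ln (/ (1 - B)) in
   let beta2 := (A - B) / (2 * B) * ln ((1 + B) ^ 5) in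
   forall z : C, Cmod z < 1 ->
     Cmod (/ zf'_over_f f z * calG f z)%C
       <= (A - B) / (1 + Rabs B) * / Rmax beta1 beta2)
  -> starlike_Ne f.
Proof.
intros H. split; [exact hf|].
assert (Hp0 := p_0 f). assert (Hnz := p_nonzero f hf hp hG).
assert (Hder := p_Cder f hf hp hG). assert (Hder2 := p_Cder2 f hp hG).
set (p := zf'_over_f f) in *. set (G := calG f) in *.
assert (Hder0 : Cder p (RtoC 0) (C_derive p (RtoC 0))).
{ apply C_derive_Cder, hp. rewrite Cmod_0. lra. }
apply subordinate_phi_Ne_of_disc; auto.
assert (H10 : RtoC 1 <> RtoC 0) by (intros E; injection E; lra).
destruct H as [H|[H|H]].
- cbv zeta in H.
  replace ((A - B) / (2 * B) * ln ((1 + B) ^ 3)) with (3 / 2 * (A - B) * (ln (1 + B) / B)) in H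
    by (rewrite ln_pow by lra; simpl INR; field; auto).
  match type of H with context [Rmax ?b _] =>
    pose proof (radius_bound A B (3 / 2) b hB hBA hB0 ltac:(lra)) as HK end.
  match type of HK with ?k < _ => set (K := k) in * end.
  intros z Hz. apply Rle_lt_trans with K; [|lra].
  (* With w = p - 1, z w' = p G is the quantity bounded in (a). *)
  apply (jack_bound (fun y => p y + - RtoC 1)%C (fun y => G y * / y * p y)%C 1 K (C_derive p (RtoC 0))); auto.
  + rewrite Hp0. ring.
  + eapply Cder_eq; [apply Cder_plus; [exact Hder0|apply Cder_const]|ring].
  + intros y Hy Hy1. split; [|split].
    * eapply Cder_eq; [apply Cder_plus; [now apply Hder|apply Cder_const]|ring].
    * now apply Hder2.
    * replace (y * (G y * / y * p y))%C with (p y * G y)%C by (field; auto). now apply H.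
- cbv zeta in H.
  assert (Hln : 0 < ln (5 / 3)) by (rewrite <- ln_1; apply ln_increasing; lra).
  replace ((A - B) / (B * ln (5 / 3)) * ln (1 + B)) with (/ ln (5 / 3) * (A - B) * (ln (1 + B) / B)) in H
    by (field; split; lra).
  match type of H with context [Rmax ?b _] =>
    pose proof (radius_bound A B (/ ln (5 / 3)) b hB hBA hB0 (Rinv_0_lt_compat _ Hln)) as HK end.
  rewrite Rinv_inv in HK.
  now apply (log_derivative_disc_bound p G _ HK).
- cbv zeta in H.
  replace ((A - B) / (2 * B) * ln ((1 + B) ^ 5)) with (5 / 2 * (A - B) * (ln (1 + B) / B)) in H
    by (rewrite ln_pow by lra; simpl INR; field; auto).
  match type of H with context [Rmax ?b _] =>
    pose proof (radius_bound A B (5 / 2) b hB hBA hB0 ltac:(lra)) as HK end.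
  match type of HK with ?k < _ => set (K := k) in * end.
  intros z Hz.
  assert (Hinv : Cmod (/ p z + - RtoC 1)%C <= K).
  (* With w = 1/p - 1, z w' = - z p'/p^2 = - G/p, the quantity bounded in (c) up to sign. *)
  { apply (jack_bound (fun y => / p y + - RtoC 1)%C (fun y => - RtoC 1 * (G y * / y * / p y))%C 1 K
      (- C_derive p (RtoC 0))%C); auto.
    - rewrite Hp0. field. auto.
    - eapply Cder_eq.
      + apply Cder_plus; [apply Cder_inv; [exact Hder0|now rewrite Hp0]|apply Cder_const].
      + rewrite Hp0. field. auto.
    - intros y Hy Hy1. assert (Hpy := Hnz y Hy1). split; [|split].
      + eapply Cder_eq.
        * apply Cder_plus; [apply Cder_inv; [now apply Hder|exact Hpy]|apply Cder_const].
        * field. auto.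
      + eexists. apply Cder_mult; [apply Cder_const|]. apply Cder_mult; [apply Cder_mult|].
        * now apply C_derive_Cder, hG.
        * apply (Cder_inv (fun y => y)); auto. apply Cder_id.
        * apply Cder_inv; [now apply Hder|exact Hpy].
      + replace (y * (- RtoC 1 * (G y * / y * / p y)))%C with (- (/ p y * G y))%C by (field; auto).
        rewrite Cmod_opp. now apply H. }
  assert (Hpz := Hnz z Hz). assert (Hpp : 0 < Cmod (p z)) by now apply Cmod_gt_0.
  (* |p - 1| <= K |p| with K < 2/5 keeps p in the disc of radius 2/3. *)
  assert (E : Cmod (p z - RtoC 1)%C = Cmod (/ p z + - RtoC 1)%C * Cmod (p z)).
  { rewrite <- Cmod_mult, Cmod_sub_sym. f_equal. field. auto. }
  pose proof (Cmod_triangle_inv (p z) (RtoC 1)) as T. rewrite Cmod_1 in T.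
  rewrite E in *. nra.
Qed.
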